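(* Let $P_1,\dots,P_n\in\mathcal F\{x_1,\dots,x_n\}$ be $n$ differential polynomials in $n$ variables and let $\mathcal P$ be a strongly quasi-regular component of the system $P=\{P_1,\dots,P_n\}$. Then: (i) the order of $\mathcal P$ is at most $\mathcal O_{\mathcal P}$; (ii) the order of $\mathcal P$ is equal to $\mathcal O_{\mathcal P}$ if and only if $\nabla_{\mathcal P}\notin\mathcal P$.
   Context: $\mathcal F$ is an ordinary differential field of characteristic $0$ with derivation $\delta$; $\mathcal F\{x_1,\dots,x_n\}$ is the ring of differential polynomials, $x_j^{(k)}=\delta^k x_j$. The radical (perfect) differential ideal $\{P\}$ generated by $P$ is uniquely a finite irredundant intersection of prime differential ideals; these are the components of $P$. For a component $\mathcal P$, $\mathcal G_{\mathcal P}/\mathcal F$ is the differential field extension where $\mathcal G_{\mathcal P}$ is the fraction field of $\mathcal F\{x\}/\mathcal P$; the order of $\mathcal P$ is the transcendence degree of $\mathcal G_{\mathcal P}/\mathcal F$. Let $\mathcal M_{\mathcal P}=\mathcal G_{\mathcal P}\otimes_{\mathcal F\{x\}}\Omega_{\mathcal F\{x\}/\mathcal F}$, a free left module over the ring of differential operators $\mathcal G_{\mathcal P}[\delta]$ with basis $\mathrm d x_1,\dots,\mathrm d x_n$; for $Q\in\mathcal F\{x\}$, $\mathrm d_{\mathcal P}Q=\sum_{j,k}\overline{\partial Q/\partial x_j^{(k)}}\,\delta^k\mathrm d x_j\in\mathcal M_{\mathcal P}$, the bar denoting the class modulo $\mathcal P$. The component $\mathcal P$ is strongly quasi-regular if the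 family $(\delta^k\mathrm d_{\mathcal P}P_i)_{1\le i\le n,\,k\in\mathbf N}$ is linearly independent over the field $\mathcal G_{\mathcal P}$. Let $a_{i,j}$ (depending on $\mathcal P$) be the greatest integer $k$ such that $\partial P_i/\partial x_j^{(k)}\notin\mathcal P$, and $a_{i,j}=-\infty$ if $\partial P_i/\partial x_j^{(k)}\in\mathcal P$ for all $k$. Put $\mathcal O_{\mathcal P}=\max_{\sigma\in S_n}\sum_{i=1}^n a_{i,\sigma(i)}$ (a sum with a term $-\infty$ is $-\infty$). The system (truncated) determinant is $\nabla_{\mathcal P}=\sum_{\sigma}\mathrm{sgn}(\sigma)\prod_{i=1}^n\partial P_i/\partial x_{\sigma(i)}^{(a_{i,\sigma(i)})}$, the sum being over those $\sigma\in S_n$ with $\sum_i a_{i,\sigma(i)}=\mathcal O_{\mathcal P}$ (for a strongly quasi-regular component $\mathcal O_{\mathcal P}$ is an integer). *)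

(* Defs.v *)
(* monalg is imported without its notations: they clash with those of boolp. *)
From HB Require Import structures.
From mathcomp Require Import all_boot all_order all_algebra all_fingroup.
From mathcomp Require Import finmap boolp classical_sets constructive_ereal.
From mathcomp Require Import -(notations) monalg.

Set Implicit Arguments.
Unset Strict Implicit.
Unset Printing Implicit Defensive.

Import GRing.Theory Order.TTheory.
Local Open Scope classical_set_scope.
Local Open Scope ring_scope.

Section Polynomials.

(* Polynomials over R in the (possibly infinitely many) variables indexed by
   I: finitely supported R-valued functions on the free commutative monoid. *)
Definition polyring (R : comNzRingType) (I : choiceType) : comNzRingType :=
  malg (cmonom I) R.

Variables (R : comNzRingType) (I : choiceType).
Implicit Types (p : polyring R I) (v : I).

Definition pvar v : polyring R I := mkmalgU (ucm v) 1.

Definition pvars p : seq I := undup (flatten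
  [seq (finsupp (cmonom_val m) : seq I) | m <- (msupp p : seq (cmonom I))]).

Definition pderiv v p : polyring R I :=
  \sum_(m <- msupp p) mkmalgU (divcm m (ucm v)) (mcoeff m p *+ m v).

Definition peval (S : comNzRingType) (iota : R -> S) (x : I -> S) p : S :=
  mmap iota (fun m : cmonom I =>
    \prod_(v <- finsupp (cmonom_val m)) x v ^+ m v) p.

End Polynomials.

Definition is_derivation (R : comNzRingType) (d : R -> R) : Prop :=
  (forall a b, d (a + b) = d a + d b) /\
  (forall a b, d (a * b) = d a * b + a * d b).

(* The variable (j, k) is the k-th derivative x_j^(k). *)
Definition dvar (n : nat) : choiceType := ('I_n * nat)%type.
Definition dvarS (n : nat) (v : dvar n) : dvar n := (v.1, v.2.+1).
Definition dpoly (F : fieldType) (n : nat) : comNzRingType :=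
  polyring F (dvar n).

Section DifferentialAlgebra.

Variables (F : fieldType) (d : F -> F) (n : nat).
Implicit Types (Q : dpoly F n) (J PP : set (dpoly F n)).

(* The derivation of F{x_1, ..., x_n}: d on the coefficients, plus the chain
   rule with x_j^(k) |-> x_j^(k+1). *)
Definition delta Q : dpoly F n :=
  \sum_(m <- msupp Q) mkmalgU m (d (mcoeff m Q)) +
  \sum_(v <- pvars Q) pderiv v Q * pvar F (dvarS v).

Definition diff_ideal J : Prop :=
  [/\ J 0,
      (forall Q1 Q2, J Q1 -> J Q2 -> J (Q1 + Q2)),
      (forall Q1 Q2, J Q2 -> J (Q1 * Q2)) &
      (forall Q, J Q -> J (delta Q))].

Definition perfect_diff_ideal J : Prop :=
  diff_ideal J /\ (forall Q k, J (Q ^+ k) -> J Q).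

Definition prime_diff_ideal J : Prop :=
  [/\ diff_ideal J, ~ J 1 &
      (forall Q1 Q2, J (Q1 * Q2) -> J Q1 \/ J Q2)].

Variable P : 'I_n -> dpoly F n.

(* {P}, the smallest perfect differential ideal containing the system *)
Definition perfect_closure : set (dpoly F n) :=
  [set Q | forall J, perfect_diff_ideal J -> (forall i, J (P i)) -> J Q].

(* PP occurs in an irredundant decomposition of {P} as a finite intersection
   of prime differential ideals; that decomposition is unique. *)
Definition is_component PP : Prop :=
  exists (m : nat) (C : 'I_m -> set (dpoly F n)),
    [/\ (forall i, prime_diff_ideal (C i)),
        \bigcap_i C i = perfect_closure,
        (forall i, \bigcap_(j in [set j | j != i]) C j <> perfect_closure) &
        (exists i, C i = PP)].

(* a_{i,j}; the supremum is -oo when the set is empty, and otherwise it is a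
   maximum because P i involves finitely many variables. *)
Definition aord PP (i j : 'I_n) : \bar int :=
  supremum -oo%E
    [set (k%:Z)%:E | k in [set k : nat | ~ PP (pderiv ((j, k) : dvar n) (P i))]].

Definition jacobi_number PP : \bar int :=
  \big[maxe/-oo%E]_(s : 'S_n) (\sum_(i < n) aord PP i (s i))%E.

(* Only meaningful when jacobi_number PP is finite; then every aord PP i (s i)
   occurring below is a natural number, which absz and fine extract. *)
Definition system_det PP : dpoly F n :=
  \sum_(s : 'S_n | (\sum_(i < n) aord PP i (s i))%E == jacobi_number PP)
    (-1) ^+ s *
    \prod_(i < n) pderiv ((s i, absz (fine (aord PP i (s i)))) : dvar n) (P i).

(* (G, dG) is the fraction field of F{x}/PP with its induced derivation;
   pi : F{x} -> G is the canonical map Q |-> class of Q modulo PP. *)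
Definition is_residue_diff_field PP (G : fieldType) (dG : G -> G)
    (pi : {rmorphism dpoly F n -> G}) : Prop :=
  [/\ (forall Q, pi Q = 0 <-> PP Q),
      (forall g, exists Q1 Q2, pi Q2 != 0 /\ g = pi Q1 / pi Q2),
      is_derivation dG &
      (forall Q, dG (pi Q) = pi (delta Q))].

End DifferentialAlgebra.

(* M_PP, the free left G[delta]-module on dx_1, ..., dx_n, presented as the
   G-vector space with basis delta^k dx_j = d(x_j^(k)), indexed by (j, k). *)
Definition dmodule (G : fieldType) (n : nat) : lmodType G :=
  malg (dvar n) G.

Section DifferentialModule.

Variables (F : fieldType) (n : nat) (G : fieldType) (dG : G -> G).
Variable pi : dpoly F n -> G.

(* left multiplication by delta: delta (c e) = dG c e + c (delta e) *)
Definition ddelta (w : dmodule G n) : dmodule G n :=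
  \sum_(v <- msupp w)
    (mkmalgU v (dG (mcoeff v w)) + mkmalgU (dvarS v) (mcoeff v w)).

Definition dform (Q : dpoly F n) : dmodule G n :=
  \sum_(v <- pvars Q) mkmalgU v (pi (pderiv v Q)).

Definition lin_indep (V : lmodType G) (T : eqType) (e : T -> V) : Prop :=
  forall (s : seq T) (c : T -> G), uniq s ->
    \sum_(t <- s) c t *: e t = 0 -> {in s, forall t, c t = 0}.

Definition strongly_quasi_regular (P : 'I_n -> dpoly F n) : Prop :=
  lin_indep (fun ik : 'I_n * nat => iter ik.2 ddelta (dform (P ik.1))).

End DifferentialModule.

Section TranscendenceDegree.

Variables (F G : fieldType) (iota : F -> G).

Definition alg_indep (m : nat) (t : 'I_m -> G) : Prop :=
  forall p : polyring F 'I_m, peval iota t p = 0 -> p = 0.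

(* largest cardinality of an algebraically independent family, +oo if the
   cardinalities are unbounded *)
Definition trdeg : \bar int :=
  supremum -oo%E
    [set (m%:Z)%:E | m in [set m : nat | exists t : 'I_m -> G, alg_indep t]].

End TranscendenceDegree.

(* order of a component, its residue field G being an F-algebra through pi *)
Definition component_order (F : fieldType) (n : nat) (G : fieldType)
    (pi : dpoly F n -> G) : \bar int :=
  trdeg (fun c : F => pi (mkmalgU mone c)).

(* Main.v *)
Require Import Defs.
From HB Require Import structures.
From mathcomp Require Import all_boot all_order all_algebra all_fingroup.
From mathcomp Require Import finmap boolp classical_sets constructive_ereal.
From mathcomp Require Import -(notations) monalg.
From mathcomp Require Import ring zify.

Set Implicit Arguments.
Unset Strict Implicit.
Unset Printing Implicit Defensive.

Import GRing.Theory Order.TTheory Num.Theory.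
Local Open Scope ring_scope.

(** Linearise the system along the component. The derivatives of the P_i give
    linear equations, rows (i, l), in the unknowns x_j^(k), columns (j, k), whose
    coefficients lin_coef are the classes of the partial derivatives. Strong
    quasi-regularity says that these equations are linearly independent over G.
    The order of the component is compared with the number of independent
    solutions of this infinite linear system, and that number is found by
    truncating the system.

    Truncation. By linear programming duality for assignments (optimal_potentials)
    there are naturals la i and mu j such that P_i has order at most mu j - la i
    in x_j, up to terms whose partial derivative is in the component, and such
    that sum(mu) - sum(la) is the Jacobi number O. Give x_j^(k)
    the level k - mu j and the l-th derivative of P_i the level l - la i. Then an
    equation of level r involves no unknown of level above r, and its coefficients
    on the unknowns of level r are those of the same matrix leading_mx for every
    r >= 0; the determinant of leading_mx is the class of the system determinant
    (system_det_value). Up to each level r >= 0 there are exactly O more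
    unknowns than equations.

    Upper bound. If t_1, ..., t_m are algebraically independent, the derivations
    of F(t) with respect to the t_i extend to the generators of G, in
    characteristic 0, and give m independent solutions (alg_indep_solutions).
    Since the equations are independent, m <= O (solutions_le). When leading_mx is
    singular, a combination of the equations of level r + 1 has no term of level
    r + 1; it is an additional equation between the unknowns up to level r, and
    m < O (solutions_lt).

    Attainment. When leading_mx is regular, there are O unknowns on which the
    solutions can be prescribed (free_box, prescribed_form). The essential point
    is that every solution phi of the linearised system is tangent to the
    component (solution_tangent): because any right-hand side can be solved, phi
    is the first order term of solutions of the system in truncated power series,
    to any order; and because the component is minimal over the system, each of
    its elements becomes nilpotent modulo the differential ideal of the system
    after multiplication by some g outside the component
    (component_multiplier). It follows that the partial derivatives of an
    algebraic relation between the classes of the O unknowns are again relations,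
    so that there is none but zero (alg_indep_exists). *)

(** * Polynomials in an arbitrary family of variables *)

Lemma big_seq_widen (V : nmodType) (I : eqType) (r s : seq I) (F : I -> V) :
  uniq r -> uniq s -> {subset r <= s} -> (forall v, v \notin r -> F v = 0) ->
  \sum_(v <- s) F v = \sum_(v <- r) F v.
Proof.
move=> ur us sub F0; rewrite (bigID (mem r)) /= [X in _ + X]big1 ?addr0 //.
rewrite -big_filter; apply: perm_big; apply: uniq_perm; rewrite ?filter_uniq //.
by move=> v; rewrite mem_filter; case: (boolP (v \in r)) => //= /sub ->.
Qed.

Section Leibniz.

Variables (A B : comNzRingType) (h : {rmorphism A -> B}) (D : A -> B).
Hypothesis DD : forall p q, D (p + q) = D p + D q.

(** For fixed q this is an additive condition on p: in a polynomial ring it only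
    has to be checked on monomials. *)
Definition leibniz p q := D (p * q) = D p * h q + h p * D q.

Lemma leibniz0l q : leibniz 0 q.
Proof.
have D0 : D 0 = 0 by apply: (addrI (D 0)); rewrite -DD !addr0.
by rewrite /leibniz mul0r D0 rmorph0 !mul0r addr0.
Qed.

Lemma leibnizC p q : leibniz p q -> leibniz q p.
Proof. by rewrite /leibniz mulrC => ->; rewrite addrC mulrC [D p * _]mulrC. Qed.

Lemma leibnizDl p1 p2 q : leibniz p1 q -> leibniz p2 q -> leibniz (p1 + p2) q.
Proof.
by rewrite /leibniz mulrDl !DD rmorphD => -> ->; rewrite !mulrDl addrACA.
Qed.

End Leibniz.

(** Induction over a polynomial ring, isolated from the encoding of polynomials:
    the constants C and the variables X generate A as a ring. *)
Definition generated_ring (R I : Type) (A : comNzRingType) (C : R -> A)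
    (X : I -> A) : Prop :=
  forall T : A -> Prop, (forall c, T (C c)) -> (forall v, T (X v)) ->
  (forall p q, T p -> T q -> T (p + q)) ->
  (forall p q, T p -> T q -> T (p * q)) -> forall p, T p.

Section ChainRule.

Variables (R : Type) (I : eqType) (A B : comNzRingType).
Variables (h : {rmorphism A -> B}) (D : A -> B) (C : R -> A) (X : I -> A).
Variables (dd : I -> A -> A) (vars : A -> seq I).

Hypothesis A_ind : generated_ring C X.
Hypothesis vars_uniq : forall p, uniq (vars p).
Hypothesis dd_out : forall v p, v \notin vars p -> dd v p = 0.
Hypothesis ddC : forall v c, dd v (C c) = 0.
Hypothesis ddX : forall v w, dd v (X w) = (w == v)%:R.
Hypothesis ddD : forall v p q, dd v (p + q) = dd v p + dd v q.
Hypothesis ddM : forall v p q, dd v (p * q) = dd v p * q + p * dd v q.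
Hypothesis DC : forall c, D (C c) = 0.
Hypothesis DD : forall p q, D (p + q) = D p + D q.
Hypothesis DM : forall p q, D (p * q) = D p * h q + h p * D q.

Local Notation chain p s := (D p = \sum_(v <- s) h (dd v p) * D (X v)).

Lemma chain_rule_abstract p : chain p (vars p).
Proof.
suff [r rP] : exists r : seq I, forall s, uniq s -> {subset r <= s} -> chain p s.
  pose s := undup (r ++ vars p).
  have us : uniq s := undup_uniq _.
  rewrite (rP s us) => [|v vr]; last by rewrite mem_undup mem_cat vr.
  apply: big_seq_widen => // [v vp|v /dd_out->]; last by rewrite rmorph0 mul0r.
  by rewrite mem_undup mem_cat vp orbT.
elim/A_ind: p => [c|w|p q [rp IHp] [rq IHq]|p q [rp IHp] [rq IHq]].
- exists [::] => s _ _; rewrite DC big1 // => v _.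
  by rewrite ddC rmorph0 mul0r.
- exists [:: w] => s us sub; rewrite (bigD1_seq w) //=; last first.
    by apply: sub; rewrite mem_head.
  rewrite ddX eqxx rmorph1 mul1r big1 ?addr0 // => v vw.
  by rewrite ddX eq_sym (negbTE vw) rmorph0 mul0r.
- exists (rp ++ rq) => s us sub; rewrite DD (IHp s) ?(IHq s) //; last first.
  + by move=> v vq; apply: sub; rewrite mem_cat vq ?orbT.
  + by move=> v vp; apply: sub; rewrite mem_cat vp ?orbT.
  by rewrite -big_split; apply: eq_bigr => v _; rewrite ddD rmorphD mulrDl.
- exists (rp ++ rq) => s us sub; rewrite DM (IHp s) ?(IHq s) //; last first.
  + by move=> v vq; apply: sub; rewrite mem_cat vq ?orbT.
  + by move=> v vp; apply: sub; rewrite mem_cat vp ?orbT.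
  rewrite mulr_suml mulr_sumr -big_split; apply: eq_bigr => v _.
  rewrite ddM rmorphD !rmorphM mulrDl mulrA; congr (_ + _).
  by rewrite mulrAC.
Qed.

End ChainRule.

Lemma rmorph_ext (R I : Type) (A B : comNzRingType) (C : R -> A) (X : I -> A)
    (f g : {rmorphism A -> B}) :
  generated_ring C X ->
  (forall c, f (C c) = g (C c)) -> (forall v, f (X v) = g (X v)) ->
  f =1 g.
Proof.
move=> A_ind fC fX p; elim/A_ind: p => // p q IHp IHq.
  by rewrite !rmorphD IHp IHq.
by rewrite !rmorphM IHp IHq.
Qed.

Section MultiplicativeAt.

Variables (A B : comNzRingType) (f : A -> B).
Hypothesis fD : forall p q, f (p + q) = f p + f q.

(** As for leibniz, an additive condition on p for fixed q. *)
Definition multiplicative_at p q := f (p * q) = f p * f q.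

Lemma multiplicative_at0 q : multiplicative_at 0 q.
Proof.
have f0 : f 0 = 0 by apply: (addrI (f 0)); rewrite -fD !addr0.
by rewrite /multiplicative_at mul0r f0 mul0r.
Qed.

Lemma multiplicative_atC p q : multiplicative_at p q -> multiplicative_at q p.
Proof. by rewrite /multiplicative_at mulrC [f q * _]mulrC. Qed.

Lemma multiplicative_atD p1 p2 q : multiplicative_at p1 q ->
  multiplicative_at p2 q -> multiplicative_at (p1 + p2) q.
Proof. by rewrite /multiplicative_at mulrDl !fD mulrDl => -> ->. Qed.

End MultiplicativeAt.

Section PolyRing.

Variables (R : comNzRingType) (I : choiceType).
Implicit Types (p q : polyring R I) (v w : I) (m : cmonom I).

Definition pconst (c : R) : polyring R I := mkmalgU mone c.

Lemma pconst_is_zmod_morphism : zmod_morphism pconst.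
Proof. by move=> a b; rewrite /pconst monalgUB. Qed.

Lemma pconst_is_monoid_morphism : monoid_morphism pconst.
Proof. by split=> [|a b]; rewrite /pconst ?mpolyCM. Qed.

HB.instance Definition _ :=
  GRing.isZmodMorphism.Build R (polyring R I) pconst pconst_is_zmod_morphism.
HB.instance Definition _ :=
  GRing.isMonoidMorphism.Build R (polyring R I) pconst
    pconst_is_monoid_morphism.

Lemma mkmalgUM m1 m2 (a b : R) :
  (mkmalgU m1 a : polyring R I) * mkmalgU m2 b = mkmalgU (mmul m1 m2) (a * b).
Proof. by rewrite [LHS]malgM_def fgmulUU. Qed.

Lemma polyring_sum_ind (T : polyring R I -> Prop) :
  T 0 -> (forall p q, T p -> T q -> T (p + q)) ->
  (forall m c, T (mkmalgU m c)) -> forall p, T p.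
Proof. by move=> T0 TD TU p; rewrite [p]monalgE; apply: big_ind. Qed.

Lemma mulcm_divcm m v : m v != 0%N -> mmul (divcm m (ucm v)) (ucm v) = m.
Proof.
move=> mv; apply/eqP/cmP=> i; rewrite cmM divcmE cmU.
by rewrite subnK //; case: (v =P i) mv => [<-|_ _]; rewrite ?leq0n // -lt0n.
Qed.

Lemma divcm_mulcm m v : divcm (mmul m (ucm v)) (ucm v) = m.
Proof. by apply/eqP/cmP=> i; rewrite divcmE cmM addnK. Qed.

Lemma polyring_generated : generated_ring pconst (@pvar R I).
Proof.
move=> T TC TX TD TM; apply: polyring_sum_ind; [|exact: TD|].
  have <- : pconst 0 = 0 by exact: rmorph0.
  exact: TC.
move=> m c; move: {2}(mdeg m) (erefl (mdeg m)) => N; elim: N m c => [|N IH] m c.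
  by move/mdeg_eq0I->; exact: TC.
move=> degm; have [v mv] : exists v, m v != 0%N.
  have [m0|[v]] := fset_0Vmem (finsupp (cmonom_val m)); last first.
    by rewrite -cmE_neq0; exists v.
  by move: degm; rewrite mdegE m0 big_seq_fset0.
rewrite -(mulcm_divcm mv) -[c]mulr1 -mkmalgUM; apply: TM (TX v).
apply: IH; move: degm; rewrite -{1}(mulcm_divcm mv) mdegM mdegU addn1.
by case.
Qed.

(** ** Partial derivatives *)

Lemma mcoeff_pderiv v p m :
  mcoeff m (pderiv v p) = mcoeff (mmul m (ucm v)) p *+ (m v).+1.
Proof.
rewrite /pderiv raddf_sum /=.
under eq_bigr do rewrite mcoeffU.
have E m' : (mcoeff m' p *+ m' v) *+ (divcm m' (ucm v) == m) =
            if m' == mmul m (ucm v)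
            then mcoeff (mmul m (ucm v)) p *+ (m v).+1 else 0.
  case: (eqVneq m' (mmul m (ucm v))) => [->|ne].
    by rewrite divcm_mulcm eqxx mulr1n cmM cmUU addn1.
  case: (eqVneq (m' v) 0%N) => [->|mv]; first by rewrite mulr0n mul0rn.
  case: (eqVneq (divcm m' (ucm v)) m) => // e.
  by rewrite -e mulcm_divcm ?eqxx in ne.
under eq_bigr do rewrite E.
rewrite -big_mkcond /=; have [sup|nsup] := boolP (mmul m (ucm v) \in msupp p).
  by rewrite -big_filter (filter_pred1_uniq (fset_uniq _) sup) big_seq1.
by rewrite mcoeff_outdom // mul0rn big1_seq // => m' /andP[/eqP-> sup].
Qed.

Lemma pcoeffD m p q : mcoeff m (p + q) = mcoeff m p + mcoeff m q.
Proof. exact: (mcoeffD m p q). Qed.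

Lemma pderivD v p q : pderiv v (p + q) = pderiv v p + pderiv v q.
Proof.
apply/malgP=> m; transitivity (mcoeff (mmul m (ucm v)) (p + q) *+ (m v).+1).
  exact: mcoeff_pderiv.
rewrite pcoeffD mulrnDl [RHS]pcoeffD.
by congr (_ + _); apply/esym; apply: mcoeff_pderiv.
Qed.

Lemma pderivU v m (c : R) :
  pderiv v (mkmalgU m c) = mkmalgU (divcm m (ucm v)) (c *+ m v).
Proof.
rewrite /pderiv msuppU; case: eqP => [->|_]; last first.
  by rewrite big_seq_fset1 mcoeffUU.
by rewrite big_seq_fset0 mul0rn monalgU0.
Qed.

Lemma divcm_mulcml m1 m2 v : m1 v != 0%N ->
  divcm (mmul m1 m2) (ucm v) = mmul (divcm m1 (ucm v)) m2.
Proof.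
move=> mv; apply/eqP/cmP=> i; rewrite divcmE !cmM divcmE cmU.
by rewrite addnBAC //; case: (v =P i) mv => [<-|_ _]; rewrite ?leq0n // -lt0n.
Qed.

Lemma pderivUM v m1 m2 (a b : R) :
  leibniz idfun (pderiv v) (mkmalgU m1 a : polyring R I) (mkmalgU m2 b).
Proof.
have E0 := etrans (congr1 (pderiv v) (mkmalgUM m1 m2 a b)) (pderivU v _ _).
have E1 := etrans (congr1 ( *%R^~ (mkmalgU m2 b)) (pderivU v m1 a))
                  (mkmalgUM _ m2 _ b).
have E2 := etrans (congr1 ( *%R (mkmalgU m1 a)) (pderivU v m2 b))
                  (mkmalgUM m1 _ a _).
have F1 : mkmalgU (divcm (mmul m1 m2) (ucm v)) ((a * b) *+ m1 v) =
          mkmalgU (mmul (divcm m1 (ucm v)) m2) ((a *+ m1 v) * b).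
  rewrite mulrnAl; have [e|mv] := eqVneq (m1 v) 0%N.
    by rewrite e !mulr0n !monalgU0.
  exact: (congr1 (mkmalgU^~ _) (divcm_mulcml m2 mv)).
have F2 : mkmalgU (divcm (mmul m1 m2) (ucm v)) ((a * b) *+ m2 v) =
          mkmalgU (mmul m1 (divcm m2 (ucm v))) (a * (b *+ m2 v)).
  rewrite mulrnAr; have [e|mv] := eqVneq (m2 v) 0%N.
    by rewrite e !mulr0n !monalgU0.
  apply: (congr1 (mkmalgU^~ _)); rewrite [mmul m1 m2]mulmC.
  exact: etrans (divcm_mulcml m1 mv) (mulmC _ _).
apply: (etrans E0); apply: (etrans _ (esym (congr2 +%R E1 E2))).
by rewrite cmM mulrnDr monalgUD; exact: (congr2 +%R F1 F2).
Qed.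

Lemma pderivM v p q : pderiv v (p * q) = pderiv v p * q + p * pderiv v q.
Proof.
suff: leibniz idfun (pderiv v) p q by [].
have DD := pderivD v.
move: p; apply: polyring_sum_ind => [|p1 p2|m1 a].
- exact: leibniz0l.
- exact: leibnizDl.
apply: leibnizC; move: q; apply: polyring_sum_ind => [|q1 q2|m2 b].
- exact: leibniz0l.
- exact: leibnizDl.
exact: pderivUM.
Qed.

Lemma pderivC v c : pderiv v (pconst c) = 0.
Proof. by rewrite pderivU cm1 mulr0n monalgU0. Qed.

Lemma pderivX v w : pderiv v (pvar R w) = (w == v)%:R.
Proof.
apply: (etrans (pderivU v _ _)); rewrite cmU.
have [->|_] := eqVneq w v; last by rewrite mulr0n monalgU0.
have e : divcm (ucm v) (ucm v) = mone by rewrite -{1}[ucm v]mul1m divcm_mulcm.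
by rewrite mulr1n; exact: (congr1 (mkmalgU^~ _) e).
Qed.

Lemma pvars_uniq p : uniq (pvars p).
Proof. exact: undup_uniq. Qed.

Lemma mem_pvars v p : pderiv v p != 0 -> v \in pvars p.
Proof.
apply: contraNT => nv; apply/eqP/malgP=> m; rewrite mcoeff_pderiv mcoeff0.
rewrite mcoeff_outdom ?mul0rn //; apply: contra nv => sup.
rewrite mem_undup; apply/flatten_mapP; exists (mmul m (ucm v)) => //.
by rewrite -cmE_neq0 cmM cmUU addn1.
Qed.

Lemma pderiv_out v p : v \notin pvars p -> pderiv v p = 0.
Proof. by move=> nv; apply/eqP; apply: contraNT nv; exact: mem_pvars. Qed.

Lemma pvars_pderiv v p : {subset pvars (pderiv v p) <= pvars p}.
Proof.
move=> w; rewrite !mem_undup => /flatten_mapP[m sup wm].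
apply/flatten_mapP; exists (mmul m (ucm v)).
  move: sup; rewrite -!mcoeff_neq0 mcoeff_pderiv.
  by apply: contra => /eqP->; rewrite mul0rn.
by move: wm; rewrite -!cmE_neq0 cmM; case: (m w).
Qed.

(** ** Evaluation *)

Section Eval.

Variables (S : comNzRingType) (iota : {rmorphism R -> S}) (x : I -> S).

Definition mon_eval m := \prod_(v <- finsupp (cmonom_val m)) x v ^+ m v.

Lemma mon_eval_widen m (s : {fset I}) : (finsupp (cmonom_val m) `<=` s)%fset ->
  mon_eval m = \prod_(v <- s) x v ^+ m v.
Proof.
move=> le; rewrite /mon_eval (big_fset_incl _ le) // => v _.
by rewrite -cmE_eq0 => /eqP->.
Qed.

Lemma mon_eval1 : mon_eval mone = 1.
Proof. by rewrite /mon_eval mdom1 big_seq_fset0. Qed.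

Lemma mon_evalM m1 m2 : mon_eval (mmul m1 m2) = mon_eval m1 * mon_eval m2.
Proof.
have le1 := fsubsetUl (finsupp (cmonom_val m1)) (finsupp (cmonom_val m2)).
have le2 := fsubsetUr (finsupp (cmonom_val m1)) (finsupp (cmonom_val m2)).
rewrite (mon_eval_widen le1) (mon_eval_widen le2) {1}/mon_eval mdomD -big_split.
by apply: eq_bigr => v _; rewrite cmM exprD.
Qed.

Lemma pevalE p : peval iota x p = mmap iota mon_eval p.
Proof. by []. Qed.

Lemma peval_is_zmod_morphism : zmod_morphism (peval iota x).
Proof. by move=> p q; rewrite !pevalE raddfB. Qed.

HB.instance Definition _ :=
  GRing.isZmodMorphism.Build (polyring R I) S (peval iota x)
    peval_is_zmod_morphism.

Lemma pevalU m c : peval iota x (mkmalgU m c) = iota c * mon_eval m.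
Proof. by rewrite pevalE mmapU. Qed.

Lemma pevalC c : peval iota x (pconst c) = iota c.
Proof. by rewrite pevalU mon_eval1 mulr1. Qed.

Lemma peval_is_monoid_morphism : monoid_morphism (peval iota x).
Proof.
split=> [|p q].
  by have <- : pconst 1 = 1 by []; rewrite pevalC rmorph1.
suff: multiplicative_at (peval iota x) p q by [].
have pevalD := raddfD (peval iota x).
move: p; apply: polyring_sum_ind => [|p1 p2|m1 a].
- exact: multiplicative_at0.
- exact: multiplicative_atD.
apply: multiplicative_atC; move: q; apply: polyring_sum_ind => [|q1 q2|m2 b].
- exact: multiplicative_at0.
- exact: multiplicative_atD.
have E := congr1 (peval iota x) (mkmalgUM m2 m1 b a).
apply: (etrans E); apply: (etrans (pevalU _ _)).
rewrite rmorphM mon_evalM mulrACA.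
exact: esym (congr2 *%R (pevalU m2 b) (pevalU m1 a)).
Qed.

HB.instance Definition _ :=
  GRing.isMonoidMorphism.Build (polyring R I) S (peval iota x)
    peval_is_monoid_morphism.

Lemma pevalX v : peval iota x (pvar R v) = x v.
Proof.
by rewrite pevalU rmorph1 mul1r /mon_eval mdomU big_seq_fset1 cmUU expr1.
Qed.

End Eval.

Lemma eq_peval (S : comNzRingType) (iota : {rmorphism R -> S}) (x y : I -> S) p :
  {in pvars p, x =1 y} -> peval iota x p = peval iota y p.
Proof.
move=> xy; rewrite !pevalE /mmap; apply: eq_big_seq => m sup; congr (_ * _).
apply: eq_big_seq => v vm; rewrite xy // mem_undup.
by apply/flatten_mapP; exists m.
Qed.

Lemma rmorph_peval (S : comNzRingType) (h : {rmorphism polyring R I -> S})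
    (iota : {rmorphism R -> S}) (x : I -> S) p :
  (forall c, h (pconst c) = iota c) -> (forall v, h (pvar R v) = x v) ->
  h p = peval iota x p.
Proof.
move=> hC hX; move: p.
apply: (rmorph_ext polyring_generated) => [c|v].
  exact: etrans (hC c) (esym (pevalC _ _ _)).
exact: etrans (hX v) (esym (pevalX _ _ _)).
Qed.

(** A derivation that kills the constants is determined by its values on the
    variables: this is the only form in which the chain rule is needed. *)
Lemma chain_rule (S : comNzRingType) (h : {rmorphism polyring R I -> S})
    (D : polyring R I -> S) :
  (forall c, D (pconst c) = 0) ->
  (forall p q, D (p + q) = D p + D q) ->
  (forall p q, D (p * q) = D p * h q + h p * D q) ->
  forall p, D p = \sum_(v <- pvars p) h (pderiv v p) * D (pvar R v).
Proof.
move=> DC DD DM.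
exact: (@chain_rule_abstract R I (polyring R I) S h D pconst (@pvar R I)
  (@pderiv R I) (@pvars R I) polyring_generated pvars_uniq pderiv_out pderivC
  pderivX pderivD pderivM DC DD DM).
Qed.

End PolyRing.

(** * The derivation of the ring of differential polynomials *)

Lemma derivation_ext (R I : Type) (A : comNzRingType) (C : R -> A) (X : I -> A)
    (D E : A -> A) :
  generated_ring C X ->
  is_derivation D -> is_derivation E ->
  (forall c, D (C c) = E (C c)) -> (forall v, D (X v) = E (X v)) -> D =1 E.
Proof.
move=> A_ind [DD DM] [ED EM] DC DX p; elim/A_ind: p => // p q IHp IHq.
  by rewrite DD ED IHp IHq.
by rewrite DM EM IHp IHq.
Qed.

Section DerivationTheory.

Variables (A : comNzRingType).
Implicit Types (D E : A -> A).

Lemma derivation0 D : is_derivation D -> D 0 = 0.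
Proof. by case=> DD _; apply: (addrI (D 0)); rewrite -DD !addr0. Qed.

Lemma derivation1 D : is_derivation D -> D 1 = 0.
Proof.
case=> _ DM; apply: (addrI (D 1)).
by rewrite addr0 -{3}[1 : A]mulr1 DM mulr1 mul1r.
Qed.

Lemma derivationX D : is_derivation D ->
  forall p k, D (p ^+ k.+1) = (p ^+ k * D p) *+ k.+1.
Proof.
move=> [DD DM] p; elim=> [|k IH]; first by rewrite expr0 mul1r expr1.
by rewrite exprS DM IH mulrnAr mulrA -exprS [D p * _]mulrC -mulrS.
Qed.

Lemma derivationD D E : is_derivation D -> is_derivation E ->
  is_derivation (fun p => D p + E p).
Proof.
move=> [DD DM] [ED EM]; split=> p q; first by rewrite DD ED addrACA.
by rewrite DM EM mulrDl mulrDr addrACA.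
Qed.

Lemma derivation_comp D E : is_derivation D -> is_derivation E ->
  is_derivation (fun p => D (E p) - E (D p)).
Proof.
move=> dD dE; have [DD DM] := dD; have [ED EM] := dE.
split=> p q; first by rewrite ED !DD ED opprD addrACA.
rewrite EM !DD !DM !ED !EM.
rewrite mulrBl mulrBr.
move: (D (E p) * q) (E p * D q) (D p * E q) (p * D (E q)) (E (D p) * q)
  (p * E (D q)) => a b c e f g.
by rewrite opprD !opprD !addrA; ring.
Qed.

Lemma derivation_const0 : is_derivation (fun _ : A => 0).
Proof. by split=> *; rewrite ?mul0r ?mulr0 addr0. Qed.

End DerivationTheory.

Definition derivation_along (A B : comNzRingType) (h : {rmorphism A -> B})
    (D : A -> B) : Prop :=
  (forall a b, D (a + b) = D a + D b) /\
  (forall a b, D (a * b) = D a * h b + h a * D b).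

Section Gradient.

Variables (A B : comNzRingType) (h : {rmorphism A -> B}) (I : eqType).
Variables (dd : I -> A -> A) (vars : A -> seq I) (y : I -> B).
Hypothesis vars_uniq : forall p, uniq (vars p).
Hypothesis dd_out : forall v p, v \notin vars p -> dd v p = 0.
Hypothesis dd_der : forall v, is_derivation (dd v).

Lemma gradient_along :
  derivation_along h (fun p => \sum_(v <- vars p) h (dd v p) * y v).
Proof.
have gradE p s : {subset vars p <= s} ->
    \sum_(v <- vars p) h (dd v p) * y v = \sum_(v <- undup s) h (dd v p) * y v.
  move=> sub; apply/esym/big_seq_widen; rewrite ?undup_uniq //.
    by move=> v /sub; rewrite mem_undup.
  by move=> v /dd_out->; rewrite rmorph0 mul0r.
split=> p q.
  rewrite (gradE (p + q) (vars p ++ vars q ++ vars (p + q))); last first.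
    by move=> v vp; rewrite !mem_cat vp !orbT.
  rewrite (gradE p (vars p ++ vars q ++ vars (p + q))); last first.
    by move=> v vp; rewrite !mem_cat vp.
  rewrite (gradE q (vars p ++ vars q ++ vars (p + q))); last first.
    by move=> v vp; rewrite !mem_cat vp orbT.
  rewrite -big_split; apply: eq_bigr => v _.
  by case: (dd_der v) => -> _; rewrite rmorphD mulrDl.
rewrite (gradE (p * q) (vars p ++ vars q ++ vars (p * q))); last first.
  by move=> v vp; rewrite !mem_cat vp !orbT.
rewrite (gradE p (vars p ++ vars q ++ vars (p * q))); last first.
  by move=> v vp; rewrite !mem_cat vp.
rewrite (gradE q (vars p ++ vars q ++ vars (p * q))); last first.
  by move=> v vp; rewrite !mem_cat vp orbT.
rewrite mulr_suml mulr_sumr -big_split; apply: eq_bigr => v _.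
by case: (dd_der v) => _ ->; rewrite rmorphD !rmorphM mulrDl mulrAC mulrA.
Qed.

End Gradient.

Lemma pderiv_derivation (R : comNzRingType) (I : choiceType) (v : I) :
  is_derivation (@pderiv R I v).
Proof. by split; [exact: pderivD|exact: pderivM]. Qed.

Section Delta.

Variables (F : fieldType) (d : F -> F) (n : nat).
Hypothesis d_der : is_derivation d.
Implicit Types (p q : dpoly F n) (v w : dvar n).

Definition coef_delta p : dpoly F n :=
  \sum_(m <- msupp p) mkmalgU m (d (mcoeff m p)).

Lemma mcoeff_coef_delta m p : mcoeff m (coef_delta p) = d (mcoeff m p).
Proof.
rewrite /coef_delta raddf_sum /=.
under eq_bigr do rewrite mcoeffU mulrb.
rewrite -big_mkcond /=; have [sup|nsup] := boolP (m \in msupp p).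
  by rewrite -big_filter (filter_pred1_uniq (fset_uniq _) sup) big_seq1.
rewrite mcoeff_outdom // (derivation0 d_der) big1_seq // => m' /andP[/eqP-> sup].
by rewrite sup in nsup.
Qed.

Lemma coef_deltaU m (c : F) :
  coef_delta (mkmalgU m c) = mkmalgU m (d c).
Proof.
apply/malgP=> m'; apply: (etrans (mcoeff_coef_delta _ _)).
apply: (etrans (congr1 d (mcoeffU m c m'))).
apply: (etrans _ (esym (mcoeffU _ _ _))).
by case: (m == m'); rewrite ?mulr1n // !mulr0n; exact: derivation0.
Qed.

Lemma coef_deltaD p q : coef_delta (p + q) = coef_delta p + coef_delta q.
Proof.
apply/malgP=> m; apply: (etrans (mcoeff_coef_delta m _)).
rewrite pcoeffD [RHS]pcoeffD; case: d_der => -> _.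
by congr (_ + _); apply/esym; apply: mcoeff_coef_delta.
Qed.

Lemma coef_deltaM p q :
  coef_delta (p * q) = coef_delta p * q + p * coef_delta q.
Proof.
suff: leibniz idfun coef_delta p q by [].
have DD := coef_deltaD.
move: p; apply: polyring_sum_ind => [|p1 p2|m1 a].
- exact: leibniz0l.
- exact: leibnizDl.
apply: leibnizC; move: q; apply: polyring_sum_ind => [|q1 q2|m2 b].
- exact: leibniz0l.
- exact: leibnizDl.
have E0 := etrans (congr1 coef_delta (mkmalgUM m2 m1 b a)) (coef_deltaU _ _).
have E1 := etrans (congr1 ( *%R^~ (mkmalgU m1 a)) (coef_deltaU m2 b))
                  (mkmalgUM _ m1 _ a).
have E2 := etrans (congr1 ( *%R (mkmalgU m2 b)) (coef_deltaU m1 a))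
                  (mkmalgUM m2 _ b _).
apply: (etrans E0); apply: (etrans _ (esym (congr2 +%R E1 E2))).
by case: d_der => _ ->; rewrite monalgUD.
Qed.

Lemma coef_delta_derivation : is_derivation coef_delta.
Proof. by split; [exact: coef_deltaD|exact: coef_deltaM]. Qed.

Lemma delta_derivation : is_derivation (@delta F d n).
Proof.
apply: (derivationD coef_delta_derivation).
exact: (gradient_along idfun (fun v => pvar F (dvarS v))
  (@pvars_uniq F (dvar n)) (@pderiv_out F (dvar n))
  (@pderiv_derivation F (dvar n))).
Qed.

Lemma deltaC c : delta d (@pconst F (dvar n) c) = pconst _ (d c).
Proof.
have E : \sum_(v <- pvars (@pconst F (dvar n) c))
    pderiv v (@pconst F (dvar n) c) * pvar F (dvarS v) = 0.
  by apply: big1 => v _; rewrite pderivC mul0r.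
apply: (etrans (congr2 +%R (coef_deltaU _ _) E)); exact: addr0.
Qed.

Lemma deltaX w : delta d (pvar F w) = pvar F (dvarS w).
Proof.
have E : \sum_(v <- pvars (pvar F w)) pderiv v (pvar F w) * pvar F (dvarS v)
    = pvar F (dvarS w).
  have sub : {subset [:: w] <= pvars (pvar F w)}.
    move=> v; rewrite inE => /eqP->; apply: mem_pvars.
    by rewrite pderivX eqxx; exact: oner_neq0.
  rewrite (@big_seq_widen _ _ [:: w]) ?pvars_uniq //.
    by rewrite big_seq1 pderivX eqxx mul1r.
  by move=> v; rewrite inE pderivX eq_sym => /negbTE->; rewrite mul0r.
have E0 : coef_delta (pvar F w) = 0.
  by apply: (etrans (coef_deltaU _ _)); rewrite (derivation1 d_der) monalgU0.
by apply: (etrans (congr2 +%R E0 E)); exact: add0r.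
Qed.

(** The commutator of two derivations is a derivation, hence known from its
    values on the variables. *)
Lemma pderiv_delta (E : dpoly F n -> dpoly F n) v :
  is_derivation E -> (forall c, E (pconst _ c) = 0) ->
  (forall w, E (pvar F w) = (dvarS w == v)%:R) ->
  forall p, pderiv v (delta d p) = delta d (pderiv v p) + E p.
Proof.
move=> E_der EC EX p.
have dd := pderiv_derivation F v.
suff <- : pderiv v (delta d p) - delta d (pderiv v p) = E p.
  exact: (esym (subrKC _ _)).
apply: (derivation_ext (@polyring_generated F (dvar n))
  (derivation_comp dd delta_derivation) E_der) => [c|w].
  have e1 := etrans (congr1 (pderiv v) (deltaC c)) (pderivC v _).
  have e2 := etrans (congr1 (@delta F d n) (pderivC v c))
                    (derivation0 delta_derivation).
  apply: (etrans (congr2 (fun a b => a - b) e1 e2)).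
  exact: etrans (subrr 0) (esym (EC c)).
have e1 := etrans (congr1 (pderiv v) (deltaX w)) (pderivX _ _ _).
have e3 (b : bool) : delta d (b%:R : dpoly F n) = 0.
  case: b; first exact: derivation1 delta_derivation.
  exact: derivation0 delta_derivation.
have e2 := etrans (congr1 (@delta F d n) (pderivX _ v w)) (e3 _).
apply: (etrans (congr2 (fun a b => a - b) e1 e2)).
exact: etrans (subr0 _) (esym (EX w)).
Qed.

Lemma pderiv_delta0 j p :
  pderiv ((j, 0%N) : dvar n) (delta d p) = delta d (pderiv ((j, 0%N) : dvar n) p).
Proof.
rewrite (pderiv_delta (derivation_const0 _)) ?addr0 // => -[i k].
by rewrite xpair_eqE andbF.
Qed.

Lemma pderiv_deltaS j k p :
  pderiv ((j, k.+1) : dvar n) (delta d p) =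
  delta d (pderiv ((j, k.+1) : dvar n) p) + pderiv ((j, k) : dvar n) p.
Proof.
apply: (pderiv_delta (pderiv_derivation _ _)) => [c|[i l]].
  exact: pderivC.
by rewrite pderivX; congr (_%:R); rewrite !xpair_eqE.
Qed.

End Delta.

Section Forms.

Variables (F : fieldType) (d : F -> F) (n : nat) (G : fieldType) (dG : G -> G).
Variable pi : {rmorphism dpoly F n -> G}.
Hypothesis d_der : is_derivation d.
Hypothesis dG_der : is_derivation dG.
Hypothesis pi_delta : forall Q, dG (pi Q) = pi (delta d Q).

Lemma mcoeff_dform Q v : mcoeff v (dform pi Q) = pi (pderiv v Q).
Proof.
rewrite /dform raddf_sum /=.
under eq_bigr do rewrite mcoeffU mulrb.
rewrite -big_mkcond /=; have [sup|nsup] := boolP (v \in pvars Q).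
  by rewrite -big_filter (filter_pred1_uniq (pvars_uniq _) sup) big_seq1.
rewrite pderiv_out // rmorph0 big1_seq // => w /andP[/eqP-> sup].
by rewrite sup in nsup.
Qed.

Lemma mcoeff_ddelta (w : dmodule G n) v :
  mcoeff v (ddelta dG w) =
  dG (mcoeff v w) + if v.2 is k.+1 then mcoeff ((v.1, k) : dvar n) w else 0.
Proof.
rewrite /ddelta raddf_sum /=.
under eq_bigr do rewrite mcoeffD !mcoeffU !mulrb.
rewrite big_split /= -!big_mkcond /=; congr (_ + _).
  have [sup|nsup] := boolP (v \in msupp w).
    by rewrite -big_filter (filter_pred1_uniq (fset_uniq _) sup) big_seq1.
  rewrite mcoeff_outdom // (derivation0 dG_der) big1_seq // => u /andP[/eqP-> s].
  by rewrite s in nsup.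
case: v => j [|k] /=.
  by rewrite big1 // => -[i l]; rewrite xpair_eqE andbF.
have E (u : dvar n) : (dvarS u == (j, k.+1)) = (u == (j, k)).
  by case: u => i l; rewrite !xpair_eqE.
under eq_bigl do rewrite E.
have [sup|nsup] := boolP (((j, k) : dvar n) \in msupp w).
  by rewrite -big_filter (filter_pred1_uniq (fset_uniq _) sup) big_seq1.
rewrite mcoeff_outdom // big1_seq // => u /andP[/eqP-> s].
by rewrite s in nsup.
Qed.

(** Differentiation of forms mirrors that of polynomials, so the prolongations
    of a linearised equation are the linearised prolongations. *)
Lemma iter_ddelta_dform Q l :
  iter l (ddelta dG) (dform pi Q) = dform pi (iter l (@delta F d n) Q).
Proof.
elim: l => [|l IH]; first by [].
apply: (etrans (congr1 (ddelta dG) IH)).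
rewrite iterS; move: (iter l (@delta F d n) Q) => T; apply/malgP=> -[j k].
apply: (etrans (mcoeff_ddelta _ _)); apply: (etrans _ (esym (mcoeff_dform _ _))).
have E := etrans (congr1 dG (mcoeff_dform T (j, k))) (pi_delta _).
case: k E => [|k] E.
  apply: (etrans (addr0 _)); apply: (etrans E).
  exact: esym (congr1 pi (pderiv_delta0 d_der j T)).
apply: (etrans (congr2 +%R E (mcoeff_dform T ((j, k) : dvar n)))).
apply: (etrans (esym (rmorphD pi _ _))).
exact: esym (congr1 pi (pderiv_deltaS d_der j k T)).
Qed.

End Forms.

(** * Components and the differential ideal of the system *)

Section Radical.

Variables (A : comNzRingType) (delta : A -> A) (J : A -> Prop).
Hypothesis delta_der : is_derivation delta.
Hypothesis J0 : J 0.
Hypothesis JD : forall a b, J a -> J b -> J (a + b).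
Hypothesis JM : forall a b, J b -> J (a * b).
Hypothesis Jdelta : forall a, J a -> J (delta a).

Definition radical (a : A) := exists k, J (a ^+ k).

Lemma ideal_sum (I : Type) (r : seq I) (T : pred I) (f : I -> A) :
  (forall i, T i -> J (f i)) -> J (\sum_(i <- r | T i) f i).
Proof. by move=> Jf; elim/big_ind: _. Qed.

Lemma ideal_opp a : J a -> J (- a).
Proof. by move=> Ja; rewrite -mulN1r; apply: JM. Qed.

Lemma ideal_exp_le a k m : (k <= m)%N -> J (a ^+ k) -> J (a ^+ m).
Proof. by move=> le_km Ja; rewrite -(subnK le_km) exprD; apply: JM. Qed.

Lemma radicalD a b : radical a -> radical b -> radical (a + b).
Proof.
move=> [k Jk] [m Jm]; exists (k + m)%N; rewrite exprDn.
apply: ideal_sum => i _; rewrite -mulr_natl; apply: JM.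
have [le_ki|lt_ik] := leqP m i.
  by apply: JM; apply: ideal_exp_le Jm.
rewrite mulrC; apply: JM; apply: ideal_exp_le Jk.
by rewrite -(addnBA _ (ltnW lt_ik)) leq_addr.
Qed.

Lemma radicalM a b : radical b -> radical (a * b).
Proof. by case=> k Jk; exists k; rewrite exprMn; apply: JM. Qed.

Lemma radical_expr a k : radical (a ^+ k) -> radical a.
Proof. by case=> m Jm; exists (k * m)%N; rewrite exprM. Qed.

Hypothesis J_div : forall a k, J (a *+ k.+1) -> J a.

(** Differentiating a^(k-s) (a')^(2s) and multiplying by a' trades one factor a
    for two factors a', up to the integer k-s, invertible in characteristic 0:
    the radical of a differential ideal is again differential. *)
Lemma radical_delta a : radical a -> radical (delta a).
Proof.
move=> [k Jk]; exists (2 * k)%N.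
suff gen s : (s <= k)%N -> J (a ^+ (k - s) * delta a ^+ (2 * s)).
  by have := gen k (leqnn k); rewrite subnn expr0 mul1r.
elim: s => [_|s IH lt_sk]; first by rewrite subn0 muln0 expr0 mulr1.
have {IH} := IH (ltnW lt_sk); rewrite -(subnSK lt_sk).
move: (k - s.+1)%N => e Jes; apply: (J_div (k := e)).
have := JM (delta a) (Jdelta Jes); have [_ dM] := delta_der.
rewrite dM derivationX // mulrDr => Jsum.
have Jrest : J (delta a * (a ^+ e.+1 * delta (delta a ^+ (2 * s)))).
  case: s {lt_sk Jsum} Jes => [|s] Jes.
    by rewrite muln0 expr0 derivation1 // !mulr0.
  have e2 : (2 * s.+1)%N = (2 * s).+2 by rewrite mulnS.
  rewrite e2 in Jes *; rewrite derivationX //.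
  rewrite mulrnAr mulrnAr -mulrnAl.
  set u := delta (delta a).
  have -> : (delta a *+ (2 * s).+2) * (a ^+ e.+1 * (delta a ^+ (2 * s).+1 * u)) =
    (u *+ (2 * s).+2) * (a ^+ e.+1 * delta a ^+ (2 * s).+2).
    rewrite !mulrnAl [delta a ^+ (2 * s).+2]exprS; congr (_ *+ _); ring.
  exact: JM.
have {Jsum Jrest} := JD Jsum (ideal_opp Jrest); rewrite addrK.
congr J; rewrite mulrnAl mulrnAr; congr (_ *+ _).
have -> : (2 * s.+1)%N = (2 * s).+2 by rewrite mulnS.
by rewrite !exprS; ring.
Qed.

End Radical.

Section Component.

Variables (F : fieldType) (d : F -> F) (n : nat) (P : 'I_n -> dpoly F n).
Hypothesis charF : [pchar F] =i pred0.
Hypothesis d_der : is_derivation d.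

Definition system_ideal : set (dpoly F n) :=
  [set Q | forall J, diff_ideal d J -> (forall i, J (P i)) -> J Q]%classic.

Lemma system_ideal_diff : diff_ideal d system_ideal.
Proof.
split=> [J [] // | Q1 Q2 J1 J2 J dJ JP | Q1 Q2 J2 J dJ JP | Q J1 J dJ JP];
  case: (dJ) => _ JD JM Jd.
- by apply: JD; [exact: J1|exact: J2].
- by apply: JM; exact: J2.
- by apply: Jd; exact: J1.
Qed.

Lemma ideal_divn (A : comNzRingType) (J : A -> Prop) (c a : A) k :
  (forall a b, J b -> J (a * b)) -> c * k%:R = 1 -> J (a *+ k) -> J a.
Proof. by move=> JM ck /(JM c); rewrite -mulr_natl mulrA ck mul1r. Qed.

Lemma dpoly_divn J (Q : dpoly F n) k : diff_ideal d J -> J (Q *+ k.+1) -> J Q.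
Proof.
case=> _ _ JM _; apply: (@ideal_divn _ J (pconst _ (k.+1%:R^-1))) => //.
have e : (k.+1%:R^-1 * k.+1%:R : F) = 1.
  by rewrite mulVf // (proj1 (pcharf0P F) charF).
have e1 := congr1 (@pconst F (dvar n)) e.
apply: (etrans _ e1); apply: (etrans _ (esym (rmorphM (@pconst F (dvar n)) _ _))).
by congr (_ * _); apply: (esym (rmorph_nat (@pconst F (dvar n)) _)).
Qed.

Lemma perfect_closure_radical Q : perfect_closure d P Q -> radical system_ideal Q.
Proof.
have dS := system_ideal_diff; have [S0 SD SM Sd] := dS.
apply; last by move=> i; exists 1%N => J _ JP; rewrite expr1; exact: JP.
split; last by move=> Q' k; apply: radical_expr.
split=> [|Q1 Q2|Q1 Q2|Q1].
- by exists 1%N; rewrite expr1; exact: S0.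
- exact: radicalD.
- exact: radicalM.
- apply: (radical_delta (delta_derivation _ d_der)) => //.
  by move=> a k; apply: dpoly_divn.
Qed.

(** A multiplier lying in all the other components but not in this one brings
    the elements of the component into the radical of the differential ideal
    of the system. *)
Lemma component_multiplier PP : is_component d P PP ->
  exists2 g, ~ PP g & forall Q, PP Q -> radical system_ideal (g * Q).
Proof.
move=> [m [C [Cprime Ccap Cirr [i <-]]]].
have [g [gC gi]] : exists g, (forall j, j != i -> C j g) /\ ~ C i g.
  apply: contrapT => no_g; apply: (Cirr i); apply/seteqP; split.
    move=> g gC; rewrite -Ccap => j _; have [->|ji] := eqVneq j i; last exact: gC.
    by apply: contrapT => gi; apply: no_g; exists g; split=> // k ki; exact: gC.
  by move=> g; rewrite -Ccap => gC j _; exact: gC.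
exists g => // Q CQ; apply: perfect_closure_radical; rewrite -Ccap => j _.
have [[_ _ CM _] _ _] := Cprime j.
have [->|ji] := eqVneq j i; last by rewrite mulrC; apply: CM; exact: gC.
by have [[_ _ CM' _] _ _] := Cprime i; exact: CM'.
Qed.

End Component.

(** * Linear forms with prescribed values *)

Section PrescribedForm.

Variables (G : fieldType) (V : lmodType G).
Implicit Types (A : set (V * G)) (u v : V) (x y c : G).

(** A linear form on a subspace of V is handled through its graph, a subspace of
    V * G; a set of pairs is consistent when the subspace it spans is the graph
    of a function. *)
Inductive graph_span A : V -> G -> Prop :=
| GraphSpan0 : graph_span A 0 0
| GraphSpanD c u x v y : A (u, x) -> graph_span A v y ->
    graph_span A (c *: u + v) (c * x + y).

Lemma graph_spanS A B u x : (A `<=` B)%classic ->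
  graph_span A u x -> graph_span B u x.
Proof.
move=> sAB; elim=> [|c w z v y /sAB Aw _ IH]; first exact: GraphSpan0.
exact: GraphSpanD.
Qed.

Lemma graph_span_in A u x : A (u, x) -> graph_span A u x.
Proof.
move=> Au; have := GraphSpanD 1 Au (GraphSpan0 A).
by rewrite scale1r mul1r !addr0.
Qed.

Lemma graph_spanP A c u x v y : graph_span A u x -> graph_span A v y ->
  graph_span A (c *: u + v) (c * x + y).
Proof.
move=> Au Av; elim: Au => [|b w z u' x' Aw _ IH].
  by rewrite scaler0 mulr0 !add0r.
rewrite scalerDr scalerA mulrDr mulrA -!addrA.
exact: GraphSpanD.
Qed.

Lemma graph_span_setU1 A v x u y : graph_span ((v, x) |` A)%classic u y ->
  exists c, graph_span A (u - c *: v) (y - c * x).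
Proof.
elim=> [|c w z u' y' [[-> ->]|Aw] _ [c' IH]].
- by exists 0; rewrite scale0r mul0r !subr0; exact: GraphSpan0.
- exists (c + c'); rewrite scalerDl mulrDl !opprD.
  by rewrite addrACA subrr add0r addrACA subrr add0r.
exists c'; rewrite -!addrA; exact: GraphSpanD.
Qed.

Definition consistent A := forall x, graph_span A 0 x -> x = 0.

Lemma graph_span_fun A u x y : consistent A ->
  graph_span A u x -> graph_span A u y -> x = y.
Proof.
move=> cA Ax Ay; apply/eqP; rewrite -subr_eq0; apply/eqP/cA.
have := graph_spanP (-1) Ay Ax; rewrite scaleN1r mulN1r addNr addrC.
by [].
Qed.

(** A pair can be added to a consistent system of prescribed values, its value
    being forced or free according to whether the vector is in the span. *)
Lemma consistent_extend A v : consistent A ->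
  exists x, consistent ((v, x) |` A)%classic.
Proof.
move=> cA; have [[x Ax]|nAv] := pselect (exists x, graph_span A v x).
  exists x => y /graph_span_setU1[c]; rewrite sub0r => Ay.
  have := graph_spanP c Ax Ay; rewrite addrN subrKC => /cA; exact.
exists 0 => y /graph_span_setU1[c]; rewrite sub0r mulr0 subr0 => Ay.
have [c0|c0] := eqVneq c 0; first by apply: cA; move: Ay; rewrite c0 scale0r oppr0.
case: nAv; exists (- c^-1 * y).
have := graph_spanP (- c^-1) Ay (GraphSpan0 A).
by rewrite scaleNr scalerN opprK scalerA mulVf // scale1r !addr0.
Qed.

Section Family.

Variables (T : eqType) (e : T -> V) (b : T -> G).
Hypothesis e_indep : lin_indep e.

Let graph0 : set (V * G) := [set p | exists t, p = (e t, b t)]%classic.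

Lemma graph0_span u x : graph_span graph0 u x -> exists (s : seq T) (c : T -> G),
  [/\ uniq s, u = \sum_(t <- s) c t *: e t & x = \sum_(t <- s) c t * b t].
Proof.
elim=> [|c w z u' x' [t [-> ->]] _ [s [a [us -> ->]]]].
  by exists [::], (fun=> 0); rewrite !big_nil.
have [r0 [ur0 mt ms]] : exists r0, [/\ uniq r0, t \in r0 & {subset s <= r0}].
  exists (undup (t :: s)); rewrite undup_uniq mem_undup mem_head; split=> // r rs.
  by rewrite mem_undup inE rs orbT.
exists r0, (fun r => (if r == t then c else 0) + (if r \in s then a r else 0)).
split=> //.
  under [RHS]eq_bigr do rewrite scalerDl; rewrite big_split /=; congr (_ + _).
    rewrite (bigD1_seq t) //= eqxx big1 ?addr0 // => r /negbTE->.
    by rewrite scale0r.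
  rewrite [RHS](big_seq_widen us ur0 ms) => [|r /negbTE->]; last by rewrite scale0r.
  by apply: eq_big_seq => r ->.
under [RHS]eq_bigr do rewrite mulrDl; rewrite big_split /=; congr (_ + _).
  rewrite (bigD1_seq t) //= eqxx big1 ?addr0 // => r /negbTE->.
  by rewrite mul0r.
rewrite [RHS](big_seq_widen us ur0 ms) => [|r /negbTE->]; last by rewrite mul0r.
by apply: eq_big_seq => r ->.
Qed.

Lemma graph0_consistent : consistent graph0.
Proof.
move=> x /graph0_span[s [c [us /esym e0 ->]]].
by rewrite big_seq big1 // => t ts; rewrite (e_indep us e0) // mul0r.
Qed.

(** A maximal consistent system of prescribed values is the graph of a linear
    form. *)
Lemma prescribed_form : exists l : V -> G,
  (forall c u v, l (c *: u + v) = c * l u + l v) /\ (forall t, l (e t) = b t).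
Proof.
pose C := [set A | consistent (A `|` graph0)%classic]%classic.
have [F FC Ftot|A [CA Amax]] := @Zorn_bigcup _ C.
  move=> x span_x; apply: contrapT => x0; apply: (x0).
  have [H|[A FA Ax]] : graph_span graph0 0 x \/
      exists2 A, F A & graph_span (A `|` graph0)%classic 0 x.
  - elim: span_x => [|c w z u y Fw _ [IH|[A FA IH]]].
    + by left; exact: GraphSpan0.
    + case: Fw => [[A FA Aw]|gw]; last by left; exact: GraphSpanD.
      right; exists A => //; apply: GraphSpanD; first by left.
      by apply: graph_spanS IH => p; right.
    + case: Fw => [[B FB Bw]|gw]; last first.
        by right; exists A => //; apply: GraphSpanD => //; right.
      have [sAB|sBA] := Ftot _ _ FA FB; right.
        exists B => //; apply: GraphSpanD; first by left.
        by apply: graph_spanS IH => p [/sAB|]; [left|right].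
      by exists A => //; apply: GraphSpanD => //; left; exact: sBA.
  - exact: graph0_consistent.
  - exact: (FC A FA).
have total v : exists x, A (v, x).
  have [x cx] := consistent_extend v CA; exists x; apply: contrapT => nA.
  apply: (Amax ((v, x) |` A)%classic); last by rewrite /C /= -setUA.
  by split=> [p|/(_ (v, x))]; [right|apply: contra_not nA; apply; left].
have {}total v : exists x, graph_span (A `|` graph0)%classic v x.
  by have [x Ax] := total v; exists x; apply: graph_span_in; left.
pose l v := projT1 (cid (total v)).
have lP v : graph_span (A `|` graph0)%classic v (l v) := projT2 (cid (total v)).
exists l; split=> [c u v|t]; apply: (graph_span_fun CA (lP _)).
  exact: graph_spanP.
by apply: graph_span_in; right; exists t.
Qed.

End Family.

End PrescribedForm.

(** * Extension of derivations *)

Section DerivationAlong.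

Variables (A B : comNzRingType) (h : {rmorphism A -> B}) (D : A -> B).
Hypothesis D_der : derivation_along h D.

Lemma derivation_along0 : D 0 = 0.
Proof. by case: D_der => DD _; apply: (addrI (D 0)); rewrite -DD !addr0. Qed.

Lemma derivation_alongN a : D (- a) = - D a.
Proof.
apply: (addrI (D a)); case: (D_der) => <- _.
by rewrite !subrr derivation_along0.
Qed.

Lemma derivation_along_sum (c : B) (E : A -> B) : derivation_along h E ->
  derivation_along h (fun a => D a + c * E a).
Proof.
move: D_der => [DD DM] [ED EM].
by split=> a b; rewrite ?DD ?ED ?DM ?EM; ring.
Qed.

End DerivationAlong.

Section AdjoinOne.

Variables (A : comNzRingType) (G : fieldType) (h : {rmorphism A -> G}).
Hypothesis charG : [pchar G] =i pred0.
Variable w : G.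

Definition adjoin_eval : {rmorphism {poly A} -> G} :=
  horner_morph (fun a => mulrC w (h a)).

Lemma adjoin_evalE p : adjoin_eval p = (map_poly h p).[w].
Proof. by []. Qed.

Lemma adjoin_evalC a : adjoin_eval a%:P = h a.
Proof. by rewrite adjoin_evalE map_polyC hornerC. Qed.

Lemma adjoin_evalX : adjoin_eval 'X = w.
Proof. by rewrite adjoin_evalE map_polyX hornerX. Qed.

Section Extend.

Variable D : A -> G.
Hypothesis D_der : derivation_along h D.

(** The derivation of A[X] that treats the new variable as a constant. *)
Definition coef_der (p : {poly A}) := (map_poly D p).[w].

Let D0 : D 0 = 0 := derivation_along0 D_der.

Lemma coef_derD p q : coef_der (p + q) = coef_der p + coef_der q.
Proof.
rewrite /coef_der -hornerD; congr (_.[w]); apply/polyP => i.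
by rewrite coefD !coef_map_id0 // coefD; case: D_der.
Qed.

Lemma coef_derC a : coef_der a%:P = D a.
Proof.
rewrite /coef_der -[RHS](hornerC _ w); congr (_.[w]); apply/polyP => i.
by rewrite coef_map_id0 // !coefC; case: eqP.
Qed.

Lemma coef_derMX p : coef_der (p * 'X) = coef_der p * w.
Proof.
rewrite /coef_der -hornerMX; congr (_.[w]); apply/polyP => i.
by rewrite coefMX !coef_map_id0 // coefMX; case: i.
Qed.

Lemma coef_derCM a q : coef_der (a%:P * q) = D a * adjoin_eval q + h a * coef_der q.
Proof.
rewrite /coef_der adjoin_evalE -!hornerCM -hornerD; congr (_.[w]).
apply/polyP => i; rewrite coefD !coefCM coef_map !coef_map_id0 // coefCM.
by case: D_der.
Qed.

Lemma coef_der_along : derivation_along adjoin_eval coef_der.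
Proof.
split=> [|p q]; first exact: coef_derD.
elim/poly_ind: p => [|p a IH].
  by rewrite mul0r rmorph0 -(polyC0 A) coef_derC D0 !mul0r addr0.
rewrite mulrDl -mulrA ['X * q]mulrC mulrA !coef_derD !coef_derMX coef_derCM IH.
rewrite coef_derC rmorphD rmorphM /= adjoin_evalC adjoin_evalX.
ring.
Qed.

(** The general extension of D: z is the derivative given to w. *)
Definition adjoin_der (z : G) (p : {poly A}) :=
  coef_der p + z * adjoin_eval p^`().

Lemma adjoin_der_along z : derivation_along adjoin_eval (adjoin_der z).
Proof.
apply: (derivation_along_sum coef_der_along); split=> p q.
  by rewrite derivD rmorphD.
by rewrite derivM rmorphD !rmorphM.
Qed.

Lemma adjoin_derC z a : adjoin_der z a%:P = D a.
Proof. by rewrite /adjoin_der derivC rmorph0 mulr0 addr0 coef_derC. Qed.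

Hypothesis D_ker : forall a, h a = 0 -> D a = 0.

Lemma adjoin_der_ker0 z p : map_poly h p = 0 -> adjoin_der z p = 0.
Proof.
move=> hp0; have hc i : h p`_i = 0 by rewrite -coef_map hp0 coef0.
rewrite /adjoin_der /coef_der adjoin_evalE -deriv_map hp0 deriv0 horner0 mulr0.
suff -> : map_poly D p = 0 by rewrite horner0 addr0.
by apply/polyP => i; rewrite coef0 coef_map_id0 // D_ker.
Qed.

(** When the new element is algebraic, its derivative is forced by a relation f
    of least degree: separability gives f' a nonzero value, and every other
    relation reduces to f by pseudo-division. *)
Lemma adjoin_der_exists :
  exists z, forall p, adjoin_eval p = 0 -> adjoin_der z p = 0.
Proof.
pose S p := adjoin_eval p = 0 /\ map_poly h p != 0.
have [[f0 Sf0]|noS] := pselect (exists p, S p); last first.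
  exists 0 => p p0; apply: adjoin_der_ker0; apply/eqP; apply/negPn/negP => hp.
  by apply: noS; exists p.
pose Q k := `[< exists2 p, S p & size p = k >].
have exQ : exists k, Q k by exists (size f0); apply/asboolP; exists f0.
have [k /asboolP[f [f_root hf] sf] minQ] := ex_minnP exQ.
have minS p : S p -> (k <= size p)%N.
  by move=> Sp; apply: minQ; apply/asboolP; exists p.
have size_lt (r : {poly A}) l : (size r <= l.+1)%N -> r`_l = 0 -> (size r <= l)%N.
  move=> sr rl; apply/leq_sizeP => i; rewrite leq_eqVlt => /orP[/eqP<- //|].
  exact: (leq_sizeP _ _ sr).
case: k sf minS {exQ minQ} => [|k] sf minS.
  move/eqP: sf hf; rewrite size_poly_eq0 => /eqP->.
  by rewrite rmorph0 eqxx.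
(* Otherwise f without its leading term would be a smaller relation. *)
have hlead : h f`_k != 0.
  apply/eqP => hl0; pose p1 := f - f`_k *: 'X^k.
  have hp1 : map_poly h p1 = map_poly h f.
    apply/polyP => i; rewrite !coef_map /= coefB coefZ coefXn rmorphB rmorphM.
    by rewrite hl0 mul0r subr0.
  have /minS : S p1 by split; rewrite ?hp1 // adjoin_evalE hp1.
  apply/negP; rewrite -ltnNge ltnS; apply: size_lt.
    rewrite (leq_trans (size_polyD _ _)) // size_polyN geq_max sf leqnn /=.
    by rewrite (leq_trans (size_scale_leq _ _)) // size_polyXn.
  by rewrite coefB coefZ coefXn eqxx mulr1 subrr.
(* The derivative of f is smaller than f, so it is not a relation unless its
   image is zero, which characteristic 0 excludes. *)
have sep : adjoin_eval f^`() != 0.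
  apply/eqP => f'0; have := @minS f^`(); rewrite leqNgt.
  have -> : (size f^`() < k.+1)%N.
    by rewrite -sf lt_size_deriv // -size_poly_gt0 sf.
  apply/not_implyP; split=> //; split=> //; rewrite -deriv_map.
  case: k sf hlead {minS} => [|k] sf hlead.
    have f0C := size1_polyC (eq_leq sf).
    move: f_root hlead; rewrite f0C adjoin_evalC coefC eqxx => ->.
    by rewrite eqxx.
  apply: contraNneq hlead => hf'0.
  have := congr1 (fun p : {poly G} => p`_k) hf'0.
  rewrite coef0 coef_deriv coef_map /= => /eqP; rewrite -mulr_natr mulf_eq0.
  by rewrite (proj1 (pcharf0P G) charG) orbF.
exists (- coef_der f / adjoin_eval f^`()).
set z := - _ / _; set E := adjoin_der z.
have [ED EM] : derivation_along adjoin_eval E := adjoin_der_along z.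
have Ef : E f = 0 by rewrite /E /adjoin_der /z divfK // addrN.
move=> p; have [N] := ubnP (size p); elim: N p => // N IH p le_pN p_root.
have [lt_pk|le_kp] := ltnP (size p) k.+1.
  apply: adjoin_der_ker0; apply/eqP; apply/negPn/negP => hp.
  by have := minS p (conj p_root hp); rewrite leqNgt lt_pk.
case sp : (size p) le_kp => [//|l] le_kl; rewrite ltnS in le_kl.
(* One step of pseudo-division: p1 is smaller than p, and E p1 is h f`_k * E p
   because f vanishes at w and E f = 0. *)
pose q := (p`_l)%:P * 'X^(l - k).
pose p1 := (f`_k)%:P * p - q * f.
have p1_root : adjoin_eval p1 = 0.
  by rewrite rmorphB !rmorphM p_root f_root !mulr0 subrr.
have sp1 : (size p1 <= l)%N.
  apply: size_lt.
    rewrite (leq_trans (size_polyD _ _)) // size_polyN geq_max; apply/andP; split.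
      by rewrite (leq_trans (size_polyMleq _ _)) // sp size_polyC; case: (_ != _).
    rewrite (leq_trans (size_polyMleq _ _)) // sf addnS /= -ltnS.
    rewrite (@leq_trans ((l - k).+1 + k).+1) //; last by rewrite ltnS addSn subnK.
    rewrite ltnS leq_add2r (leq_trans (size_polyMleq _ _)) // size_polyXn.
    by rewrite size_polyC; case: (_ != _).
  rewrite coefB coefCM -mulrA coefCM coefXnM ltnNge leq_subr /= subKn // mulrC.
  by rewrite subrr.
have : E p1 = 0.
  by apply: IH => //; rewrite sp in le_pN; exact: leq_ltn_trans sp1 _.
rewrite /p1 ED (derivation_alongN (conj ED EM)) !EM Ef p_root f_root.
rewrite !mulr0 add0r addr0 subr0 adjoin_evalC => /eqP.
by rewrite mulf_eq0 (negbTE hlead) => /eqP.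
Qed.

End Extend.
End AdjoinOne.

(** Polynomial rings over A0 mapping to G, in place of subfields of G, let the
    elements of ws be adjoined one at a time without fractions. *)
Lemma extend_derivations (G : fieldType) (m : nat) (A0 : comNzRingType)
    (h0 : {rmorphism A0 -> G}) (D0 : 'I_m -> A0 -> G) (ws : seq G) :
  [pchar G] =i pred0 ->
  (forall i, derivation_along h0 (D0 i)) ->
  (forall i a, h0 a = 0 -> D0 i a = 0) ->
  exists (A : comNzRingType) (j : {rmorphism A0 -> A}) (h : {rmorphism A -> G})
         (D : 'I_m -> A -> G),
    [/\ (forall i, derivation_along h (D i)),
        (forall i a, h a = 0 -> D i a = 0),
        (forall a, h (j a) = h0 a),
        (forall i a, D i (j a) = D0 i a) &
        {in ws, forall w, exists a, h a = w}].
Proof.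
move=> charG D0_der D0_ker; elim: ws => [|w ws [A [j [h [D [Dd Dk hj Dj hws]]]]]].
  by exists A0, idfun, h0, D0; split.
pose z i := projT1 (cid (adjoin_der_exists charG w (Dd i) (Dk i))).
have zP i := projT2 (cid (adjoin_der_exists charG w (Dd i) (Dk i))).
exists {poly A}, (polyC \o j), (adjoin_eval h w),
  (fun i => adjoin_der h w (D i) (z i)).
split=> [i|i a||i a|v].
- exact: adjoin_der_along.
- exact: zP.
- by move=> a; rewrite /= -hj; exact: adjoin_evalC.
- by rewrite /= adjoin_derC.
rewrite inE => /orP[/eqP->|/hws[a <-]]; first by exists 'X; exact: adjoin_evalX.
by exists a%:P; exact: adjoin_evalC.
Qed.

(** * Optimal assignments *)

Section Hall.

Variables (I J : finType).
Implicit Types (E : {set I * J}) (X : {set I}).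

Definition nbrs E X : {set J} := [set j | [exists i in X, (i, j) \in E]].

Lemma nbrsP E X j : reflect (exists2 i, i \in X & (i, j) \in E) (j \in nbrs E X).
Proof. by rewrite inE; exact: exists_inP. Qed.

(** Remove edges as long as the marriage condition survives. If some i kept two
    neighbours j1 and j2, neither (i, j1) nor (i, j2) could be removed; the two
    obstructing sets would contradict the submodularity of the number of
    neighbours. *)
Lemma hall E : (forall X, (#|X| <= #|nbrs E X|)%N) ->
  exists2 f : I -> J, injective f & forall i, (i, f i) \in E.
Proof.
have [N] := ubnP #|E|; elim: N E => // N IH E le_EN hallE.
have [[[[i j1] j2] /= [Ej1 Ej2 j12]]|uniqE] := pselect (exists u : I * J * J,
    [/\ (u.1.1, u.1.2) \in E, (u.1.1, u.2) \in E & u.1.2 != u.2]); last first.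
  have hasE i : exists j, (i, j) \in E.
    have := hallE [set i]; rewrite cards1 card_gt0 => /set0Pn[j /nbrsP[i']].
    by rewrite inE => /eqP->; exists j.
  pose f i := projT1 (cid (hasE i)).
  have fE i : (i, f i) \in E := projT2 (cid (hasE i)).
  have funE i j : (i, j) \in E -> j = f i.
    move=> ij; apply/eqP/negPn/negP => ne; apply: uniqE.
    by exists ((i, j), f i); split.
  exists f => // i i' eq_f; apply/eqP/negPn/negP => ne.
  have := hallE [set i; i']; rewrite cards2 ne; apply/negP; rewrite -ltnNge.
  apply: (@leq_ltn_trans #|[set f i]|); last by rewrite cards1.
  apply: subset_leq_card.
  apply/fintype.subsetP => j /nbrsP[k]; rewrite !inE => /orP[] /eqP-> /funE->.
    by [].
  by rewrite eq_f.
(* Without (i, j) either the marriage condition still holds, or it fails on some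
   set, which must contain i. *)
have removal j : (i, j) \in E ->
    (exists2 f : I -> J, injective f & forall i, (i, f i) \in E) \/
    exists2 X : {set I}, i \in X & (#|nbrs (E :\ (i, j)) X| < #|X|)%N.
  move=> Ej; have [hall'|nhall] :=
    pselect (forall X, (#|X| <= #|nbrs (E :\ (i, j)) X|)%N).
    have lt_E : (#|E :\ (i, j)| < N)%N by rewrite (cardsD1 (i, j)) Ej in le_EN.
    left; have [f finj fE] := IH _ lt_E hall'.
    by exists f => // k; have := fE k; rewrite !inE => /andP[].
  right; have [X /negP] : exists X, ~ (#|X| <= #|nbrs (E :\ (i, j)) X|)%N.
    apply: contrapT => nX; apply: nhall => X; apply: contrapT => nle.
    by apply: nX; exists X.
  rewrite -ltnNge => ltX; exists X => //; apply/negPn/negP => iX.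
  have := hallE X; rewrite leqNgt => /negP; apply.
  apply: leq_ltn_trans ltX; apply: subset_leq_card.
  apply/fintype.subsetP => k /nbrsP[i' i'X i'k].
  apply/nbrsP; exists i' => //; rewrite !inE i'k andbT xpair_eqE negb_and.
  by case: (eqVneq i' i) => // e; rewrite -e i'X in iX.
case: (removal j1 Ej1) => // -[X1 iX1 lt1].
case: (removal j2 Ej2) => // -[X2 iX2 lt2].
have subU : nbrs E (X1 :|: X2) \subset
    nbrs (E :\ (i, j1)) X1 :|: nbrs (E :\ (i, j2)) X2.
  apply/fintype.subsetP => j /nbrsP[k]; rewrite inE => kX kj.
  have [ki|ki] := eqVneq k i; last first.
    rewrite inE; apply/orP; case/orP: kX => kX; [left|right]; apply/nbrsP;
      by exists k; rewrite // !inE kj andbT xpair_eqE (negbTE ki).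
  subst k; rewrite inE; apply/orP; have [jj1|jj1] := eqVneq j j1.
    right; apply/nbrsP; exists i; rewrite // !inE kj andbT xpair_eqE eqxx /=.
    by rewrite jj1.
  by left; apply/nbrsP; exists i; rewrite // !inE kj andbT xpair_eqE eqxx /=.
have subI : nbrs E ((X1 :&: X2) :\ i) \subset
    nbrs (E :\ (i, j1)) X1 :&: nbrs (E :\ (i, j2)) X2.
  apply/fintype.subsetP => j /nbrsP[k]; rewrite !inE => /and3P[ki kX1 kX2] kj.
  apply/andP; split; apply/exists_inP; exists k => //;
    by rewrite !inE kj andbT xpair_eqE (negbTE ki).
have := leq_add (leq_trans (hallE _) (subset_leq_card subU))
                (leq_trans (hallE _) (subset_leq_card subI)).
rewrite cardsUI => le_sum.
have := cardsUI X1 X2; rewrite [#|X1 :&: X2|](cardsD1 i) !inE iX1 iX2 /=.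
by move: le_sum lt1 lt2; lia.
Qed.

End Hall.

Section Potentials.

Variables (n : nat) (c : 'I_n -> 'I_n -> nat -> bool).
Implicit Types (la mu : 'I_n -> nat).

Definition feasible la mu := forall i j k, c i j k -> (k + la i <= mu j)%N.

Definition tight la mu i j := (la i <= mu j)%N && c i j (mu j - la i).

(** Egervary's duality: a feasible pair of least value has a perfect matching
    among its tight entries, since otherwise raising the potentials on a set
    violating the marriage condition and on its neighbours lowers the value. *)
Lemma optimal_potentials :
  (exists la mu, feasible la mu) ->
  (forall la mu, feasible la mu -> (\sum_i la i <= \sum_j mu j)%N) ->
  exists la mu, feasible la mu /\ exists s : 'S_n, forall i, tight la mu i (s i).
Proof.
move=> [la [mu feas]] weak; move: la mu feas.
suff gen N la mu : (\sum_j mu j - \sum_i la i < N)%N -> feasible la mu ->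
    exists la mu, feasible la mu /\ exists s : 'S_n, forall i, tight la mu i (s i).
  by move=> la mu; apply: gen (ltnSn _).
elim: N la mu => // N IH la mu ltN feas.
pose E := [set u | tight la mu u.1 u.2].
have [hallE|nhall] := pselect (forall X : {set 'I_n}, (#|X| <= #|nbrs E X|)%N).
  have [f finj fE] := hall hallE; exists la, mu; split=> //.
  by exists (perm finj) => i; rewrite permE; have := fE i; rewrite inE.
have [X /negP] : exists X : {set 'I_n}, ~ (#|X| <= #|nbrs E X|)%N.
  apply: contrapT => nX; apply: nhall => X; apply: contrapT => nle.
  by apply: nX; exists X.
rewrite -ltnNge => ltX.
pose la' i := (la i + (i \in X))%N; pose mu' j := (mu j + (j \in nbrs E X))%N.
have feas' : feasible la' mu'.
  move=> i j k cijk; have le := feas _ _ _ cijk; rewrite /la' /mu'.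
  have [iX|_] := boolP (i \in X); last by rewrite addn0 (leq_trans le) ?leq_addr.
  have [jX|jX] := boolP (j \in nbrs E X); first by rewrite addnA leq_add2r.
  rewrite addn0 addnA addn1 ltn_neqAle le andbT; apply: contraNneq jX => e.
  apply/nbrsP; exists i => //; rewrite inE /= /tight -e leq_addl.
  by rewrite addnK.
apply: (IH la' mu') => //.
have sumE (Y : {set 'I_n}) : (\sum_i (i \in Y) = #|Y|)%N.
  by rewrite -sum1_card [RHS]big_mkcond; apply: eq_bigr => i _; case: (i \in Y).
have := weak _ _ feas'; rewrite /la' /mu' !big_split /= !sumE.
move: ltN ltX (weak _ _ feas).
by move: #|nbrs E X| #|X| (\sum_i la i)%N (\sum_i mu i)%N; lia.
Qed.

End Potentials.

(** * Deformation of the generic solution *)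

Lemma iter_derivationD (A : comNzRingType) (D : A -> A) l a b :
  is_derivation D -> iter l D (a + b) = iter l D a + iter l D b.
Proof. by move=> [DD _]; elim: l => //= l ->. Qed.

Section LargestDifferentialIdeal.

Variables (A : comNzRingType) (D : A -> A) (K : A -> Prop).
Hypothesis D_der : is_derivation D.
Hypothesis K0 : K 0.
Hypothesis KD : forall a b, K a -> K b -> K (a + b).
Hypothesis KM : forall a b, K b -> K (a * b).

Definition all_derivatives a := forall l, K (iter l D a).

Lemma all_derivatives0 : all_derivatives 0.
Proof.
move=> l; suff -> : iter l D 0 = 0 by [].
by elim: l => //= l ->; exact: derivation0.
Qed.

Lemma all_derivativesD a b :
  all_derivatives a -> all_derivatives b -> all_derivatives (a + b).
Proof. by move=> Ka Kb l; rewrite iter_derivationD //; exact: KD. Qed.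

Lemma all_derivatives_der a : all_derivatives a -> all_derivatives (D a).
Proof. by move=> Ka l; have := Ka l.+1; rewrite iterSr. Qed.

Lemma all_derivativesM a b : all_derivatives b -> all_derivatives (a * b).
Proof.
move=> Kb l; elim: l a b Kb => [|l IH] a b Kb; first exact: (KM a (Kb 0%N)).
rewrite iterSr; case: (D_der) => _ ->; rewrite iter_derivationD //; apply: KD.
  exact: IH.
by apply: IH; exact: all_derivatives_der.
Qed.

End LargestDifferentialIdeal.

Section Taylor.

Variables (G : fieldType) (A : comNzRingType).
Variables (Psi Psi' : {rmorphism A -> {poly G}}).

Lemma coef_agree_ind (R I : Type) (C : R -> A) (X : I -> A) m :
  generated_ring C X ->
  (forall c, Psi' (C c) = Psi (C c)) ->
  (forall v k, (k <= m)%N -> (Psi' (X v))`_k = (Psi (X v))`_k) ->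
  forall a k, (k <= m)%N -> (Psi' a)`_k = (Psi a)`_k.
Proof.
move=> A_ind agC agX; elim/A_ind => [c|v|p q IHp IHq|p q IHp IHq] k le_km.
- by rewrite agC.
- exact: agX.
- by rewrite !rmorphD !coefD IHp ?IHq.
rewrite !rmorphM !coefM; apply: eq_bigr => i _; rewrite IHp ?IHq //.
  by rewrite (leq_trans _ le_km) // leq_subr.
by rewrite (leq_trans _ le_km) // -ltnS.
Qed.

(** Two morphisms to power series that agree up to order m differ in order m+1
    by a derivation. *)
Lemma coef_diff_along (h : {rmorphism A -> G}) m :
  (forall a, (Psi a)`_0 = h a) ->
  (forall a k, (k <= m)%N -> (Psi' a)`_k = (Psi a)`_k) ->
  derivation_along h (fun a => (Psi' a)`_m.+1 - (Psi a)`_m.+1).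
Proof.
move=> Psi0 agree; split=> a b.
  by rewrite !rmorphD !coefD opprD addrACA.
have ends (p q : {poly G}) : (p * q)`_m.+1 =
    p`_0 * q`_m.+1 + \sum_(i < m) p`_i.+1 * q`_(m - i) + p`_m.+1 * q`_0.
  by rewrite coefM big_ord_recl big_ord_recr /= subn0 subnn addrA.
rewrite !rmorphM !ends !(agree _ _ (leq0n m)) !Psi0.
rewrite (eq_bigr (fun i : 'I_m => (Psi a)`_i.+1 * (Psi b)`_(m - i))).
  by move: (\sum_(i < m) _) => S; ring.
by move=> i _; rewrite !agree ?leq_subr.
Qed.

Definition vanish_to m a := forall k, (k <= m)%N -> (Psi a)`_k = 0.

Lemma vanish_to0 m : vanish_to m 0.
Proof. by move=> k _; rewrite rmorph0 coef0. Qed.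

Lemma vanish_toD m a b : vanish_to m a -> vanish_to m b -> vanish_to m (a + b).
Proof.
by move=> a0 b0 k le_km; rewrite rmorphD coefD a0 // b0 // addr0.
Qed.

Lemma vanish_toM m a b : vanish_to m b -> vanish_to m (a * b).
Proof.
move=> b0 k le_km; rewrite rmorphM coefM big1 // => i _.
by rewrite b0 ?mulr0 // (leq_trans (leq_subr _ _)).
Qed.

(** A power series of order one has its k-th power of order exactly k. *)
Lemma vanish_to_expr k a : vanish_to k (a ^+ k) -> (Psi a)`_0 = 0 ->
  (Psi a)`_1 = 0.
Proof.
move=> ak a0; have := ak k (leqnn k).
have /factor_theorem[r rE] : root (Psi a) 0 by rewrite /root horner_coef0 a0.
rewrite subr0 in rE; rewrite rmorphXn rE exprMn coefMXn ltnn subnn coefMX /=.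
by rewrite -!horner_coef0 horner_exp => /eqP; rewrite expf_eq0 => /andP[_ /eqP].
Qed.

End Taylor.

Section Deformation.

Variables (F : fieldType) (d : F -> F) (n : nat) (P : 'I_n -> dpoly F n).
Variables (PP : set (dpoly F n)) (G : fieldType) (dG : G -> G).
Variable pi : {rmorphism dpoly F n -> G}.
Hypothesis charF : [pchar F] =i pred0.
Hypothesis d_der : is_derivation d.
Hypothesis PP_comp : is_component d P PP.
Hypothesis pi_res : is_residue_diff_field d PP dG pi.
Hypothesis sqr : strongly_quasi_regular dG pi P.

(** The value at Q of the derivation along pi that kills the constants and maps
    each variable v to phi v; that is, of the linear form with coordinates phi
    at the differential of Q. *)
Definition dpair (phi : dvar n -> G) (Q : dpoly F n) : G :=
  \sum_(v <- pvars Q) pi (pderiv v Q) * phi v.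

Definition prolongation i l : dpoly F n := iter l (@delta F d n) (P i).

Lemma dpair_widen phi Q (s : seq (dvar n)) : uniq s ->
  (forall v, v \notin s -> pi (pderiv v Q) = 0) ->
  dpair phi Q = \sum_(v <- s) pi (pderiv v Q) * phi v.
Proof.
move=> us out; rewrite /dpair.
have ur : uniq (undup (pvars Q ++ s)) := undup_uniq _.
rewrite -(big_seq_widen (pvars_uniq Q) ur); last 2 first.
- by move=> v vQ; rewrite mem_undup mem_cat vQ.
- by move=> v /pderiv_out->; rewrite rmorph0 mul0r.
apply: big_seq_widen => // v; first by move=> vs; rewrite mem_undup mem_cat vs orbT.
by move/out->; rewrite mul0r.
Qed.

(** The linear form given by prescribed_form, recorded by its coordinates phi. *)
Lemma form_solution (T : eqType) (e : T -> dmodule G n) (b : T -> G) :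
  lin_indep e ->
  exists phi : dvar n -> G,
    (forall t Q, e t = dform pi Q -> dpair phi Q = b t) /\
    (forall t v, e t = mkmalgU v 1 -> phi v = b t).
Proof.
move=> /prescribed_form-/(_ b)[l [l_lin le]]; exists (fun v => l (mkmalgU v 1)).
have l0 : l 0 = 0.
  by apply: (addrI (1 * l 0)); rewrite -l_lin scaler0 !addr0 mul1r.
split=> [t Q etQ|t v <- //]; rewrite -le etQ /dform /dpair.
elim: (pvars Q) => [|v s IH]; first by rewrite !big_nil.
rewrite !big_cons IH -l_lin; congr (l (_ + _)); apply/malgP => w.
by rewrite mcoeffZ !mcoeffU !mulrb; case: ifP; rewrite ?mulr1 ?mulr0.
Qed.

Lemma prolongation_form i l :
  iter l (ddelta dG) (dform pi (P i)) = dform pi (prolongation i l).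
Proof. by case: pi_res => _ _ dG_der pi_delta; exact: iter_ddelta_dform. Qed.

Lemma prolongation_solution (b : 'I_n * nat -> G) : exists phi : dvar n -> G,
  forall i l, dpair phi (prolongation i l) = b (i, l).
Proof.
have [phi [phiP _]] := form_solution b sqr; exists phi => i l.
by apply: phiP; exact: prolongation_form.
Qed.

Lemma component_diff_ideal : diff_ideal d PP.
Proof. by case: PP_comp => m [C [Cp _ _ [i <-]]]; case: (Cp i). Qed.

Lemma prolongation_in_component i l : PP (prolongation i l).
Proof.
have [_ _ _ PPd] := component_diff_ideal; elim: l => [|l]; last exact: PPd.
case: PP_comp => m [C [Cp Ccap _ [j <-]]].
have : perfect_closure d P (P i) by move=> J _; exact.
by rewrite -Ccap; exact.
Qed.

(** Q at a point whose coordinates are power series over G, represented by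
    polynomials of which only the low order coefficients matter. *)
Definition series_eval (X : dvar n -> {poly G}) :
    {rmorphism dpoly F n -> {poly G}} :=
  peval (polyC \o (pi \o @pconst F (dvar n))) X.

Lemma series_evalC X c :
  series_eval X (@pconst F (dvar n) c) = (pi (@pconst F (dvar n) c))%:P.
Proof. exact: pevalC. Qed.

Lemma series_evalX X v : series_eval X (pvar F v) = X v.
Proof. exact: pevalX. Qed.

Lemma series_eval_const Q : series_eval (fun v => (pi (pvar F v))%:P) Q = (pi Q)%:P.
Proof.
apply/esym.
exact: (rmorph_peval (h := (polyC \o pi))).
Qed.

(** X is a deformation of the generic point of the component. *)
Definition deforms (X : dvar n -> {poly G}) := forall v, (X v)`_0 = pi (pvar F v).

Lemma series_eval_agree (X X' : dvar n -> {poly G}) m :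
  (forall v k, (k <= m)%N -> (X' v)`_k = (X v)`_k) ->
  forall Q k, (k <= m)%N -> (series_eval X' Q)`_k = (series_eval X Q)`_k.
Proof.
move=> agree.
apply: (coef_agree_ind (@polyring_generated F (dvar n))) => [c|v k le_km].
  exact: etrans (series_evalC X' c) (esym (series_evalC X c)).
have := agree v k le_km; rewrite -{1}(series_evalX X' v) -{1}(series_evalX X v).
by [].
Qed.

Lemma series_eval0 X Q : deforms X -> (series_eval X Q)`_0 = pi Q.
Proof.
move=> X0; have := @series_eval_agree (fun v => (pi (pvar F v))%:P) X 0.
move=> ->; first by rewrite series_eval_const coefC.
  by move=> v k; rewrite leqn0 => /eqP->; rewrite X0 coefC.
by [].
Qed.

Lemma series_eval_taylor (X X' : dvar n -> {poly G}) m Q : deforms X ->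
  (forall v k, (k <= m)%N -> (X' v)`_k = (X v)`_k) ->
  (series_eval X' Q)`_m.+1 = (series_eval X Q)`_m.+1 +
    dpair (fun v => (X' v)`_m.+1 - (X v)`_m.+1) Q.
Proof.
move=> X0 agree.
have [DD DM] := coef_diff_along (fun a => series_eval0 a X0)
                  (series_eval_agree agree).
have DC c : (series_eval X' (@pconst F (dvar n) c))`_m.+1 -
            (series_eval X (@pconst F (dvar n) c))`_m.+1 = 0.
  by rewrite !series_evalC subrr.
have := chain_rule DC DD DM Q => /eqP; rewrite subr_eq addrC => /eqP->.
congr (_ + _); apply: eq_bigr => v _.
have e (Y : dvar n -> {poly G}) :=
  congr1 (fun p : {poly G} => p`_m.+1) (series_evalX Y v).
exact: (congr1 ( *%R _) (congr2 (fun x y => x - y) (e X') (e X))).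
Qed.

(** The linearised system can be solved with any right-hand side, so a solution
    to first order lifts to every order. *)
Lemma deformation_exists phi m :
  (forall i l, dpair phi (prolongation i l) = 0) ->
  exists X, [/\ deforms X, (forall v, (X v)`_1 = phi v) &
    forall i l k, (k <= m.+1)%N -> (series_eval X (prolongation i l))`_k = 0].
Proof.
have pi0 i l : pi (prolongation i l) = 0.
  by case: pi_res => pi_ker _ _ _; apply/pi_ker; exact: prolongation_in_component.
move=> phi0; elim: m => [|m [X [X0 X1 XP]]].
  pose X0 v := (pi (pvar F v))%:P; pose X v := X0 v + phi v *: 'X.
  have X00 : deforms X0 by move=> v; rewrite coefC.
  have Xc0 v : (X v)`_0 = (X0 v)`_0 by rewrite coefD coefZ coefX mulr0 addr0.
  have Xc1 v : (X v)`_1 = phi v by rewrite coefD coefC coefZ coefX mulr1 add0r.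
  have Xdef : deforms X by move=> v; rewrite Xc0.
  exists X; split=> // i l [|[|//]] _; first by rewrite series_eval0.
  rewrite (series_eval_taylor _ X00) => [|v k]; last first.
    by rewrite leqn0 => /eqP->.
  rewrite series_eval_const coefC add0r -[RHS](phi0 i l).
  by apply: eq_bigr => v _; rewrite Xc1 coefC subr0.
(* psi compensates the coefficients of order m + 2. *)
have [psi psiP] := prolongation_solution
  (fun il => - (series_eval X (prolongation il.1 il.2))`_m.+2).
pose X' v := X v + psi v *: 'X^(m.+2).
have agree v k : (k <= m.+1)%N -> (X' v)`_k = (X v)`_k.
  by move=> le_km; rewrite coefD coefZ coefXn ltn_eqF // mulr0 addr0.
exists X'; split=> [v|v|i l k]; rewrite ?agree //.
rewrite leq_eqVlt => /orP[/eqP->|le_km]; last first.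
  by rewrite (series_eval_agree agree) //; exact: XP.
rewrite (series_eval_taylor _ X0 agree).
rewrite -[RHS](addrN (series_eval X (prolongation i l))`_m.+2).
congr (_ + _); rewrite -(psiP i l); apply: eq_bigr => v _.
by rewrite coefD coefZ coefXn eqxx mulr1 addrAC subrr add0r.
Qed.

(** A solution of the linearised system is tangent to the component. Indeed
    (g Q)^k belongs to the differential ideal of the system for some g outside
    the component; along a deformation in the direction phi that satisfies the
    system beyond order k it must vanish beyond order k, whereas it would have
    order k if g Q vanished to order one only. *)
Lemma solution_tangent phi : (forall i l, dpair phi (prolongation i l) = 0) ->
  forall Q, PP Q -> dpair phi Q = 0.
Proof.
move=> phi0 Q PPQ; case: (pi_res) => pi_ker _ _ _.
have [g ngP gP] := component_multiplier charF d_der PP_comp.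
have [k gQk] := gP Q PPQ; have [X [X0 X1 XP]] := deformation_exists k phi0.
pose Psi := series_eval X; pose K := vanish_to Psi k.
have delta_der := delta_derivation n d_der.
have K0 : K 0 := @vanish_to0 _ _ Psi k.
have KD a b : K a -> K b -> K (a + b) := @vanish_toD _ _ Psi k a b.
have KM a b : K b -> K (a * b) := @vanish_toM _ _ Psi k a b.
have dK : diff_ideal d (all_derivatives (@delta F d n) K).
  split.
  - exact (all_derivatives0 delta_der K0).
  - exact (all_derivativesD delta_der KD).
  - exact (all_derivativesM delta_der KD KM).
  - exact (@all_derivatives_der _ (@delta F d n) K).
have KP i : all_derivatives (@delta F d n) K (P i).
  by move=> l j le_jk; apply: XP; exact: leqW.
have gQ0 : (Psi (g * Q))`_0 = 0.
  rewrite series_eval0 //; apply/pi_ker.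
  by have [_ _ PM _] := component_diff_ideal; exact: PM.
have gQ1 := vanish_to_expr (gQk _ dK KP 0%N) gQ0.
have Q1 : (Psi Q)`_1 = dpair phi Q.
  pose Y v := (pi (pvar F v))%:P.
  have Y0 : deforms Y by move=> v; rewrite coefC.
  rewrite (series_eval_taylor (X := Y) _ Y0) => [|v j]; last first.
    by rewrite leqn0 => /eqP->; rewrite X0 coefC.
  rewrite series_eval_const coefC add0r; apply: eq_bigr => v _.
  by rewrite X1 coefC subr0.
have Q0 : (Psi Q)`_0 = 0 by rewrite series_eval0 //; apply/pi_ker.
have pig : pi g != 0 by apply/eqP => /pi_ker.
have coef1M (p q : {poly G}) : q`_0 = 0 -> (p * q)`_1 = p`_0 * q`_1.
  by move=> q0; rewrite coefM big_ord_recl big_ord1 /= subn0 subnn q0 mulr0 addr0.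
have e := congr1 (fun p : {poly G} => p`_1) (rmorphM Psi g Q).
have e1 := etrans (esym gQ1) (etrans e (coef1M _ _ Q0)).
have e2 := etrans e1 (congr2 *%R (series_eval0 g X0) Q1).
by move/esym/eqP: e2; rewrite mulf_eq0 (negbTE pig) => /eqP.
Qed.

End Deformation.

(** * Counting equations and unknowns *)

Section FiniteSystems.

Variables (G : fieldType) (T U : eqType) (es : seq T) (us : seq U).
Variable e : T -> U -> G.
Hypothesis es_uniq : uniq es.
Hypothesis e_indep : forall c : T -> G,
  {in us, forall v, \sum_(t <- es) c t * e t v = 0} -> {in es, forall t, c t = 0}.

Let A : 'M[G]_(size es, size us) :=
  \matrix_(a, b) e (tnth (in_tuple es) a) (tnth (in_tuple us) b).

Let coef (x : 'rV[G]_(size es)) (t : T) : G :=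
  \sum_(a | tnth (in_tuple es) a == t) x 0 a.

Let coefE x a : coef x (tnth (in_tuple es) a) = x 0 a.
Proof.
rewrite /coef (big_pred1 a) // => b /=.
by apply/eqP/eqP => [|-> //]; apply/tuple_uniqP.
Qed.

Let mulE x b : (x *m A) 0 b =
  \sum_(t <- es) coef x t * e t (tnth (in_tuple us) b).
Proof. by rewrite mxE [RHS]big_tnth; apply: eq_bigr => a _; rewrite coefE mxE. Qed.

Let A_inj (x : 'rV[G]_(size es)) : x *m A = 0 -> x = 0.
Proof.
move=> xA0; apply/rowP => a; rewrite mxE -coefE; apply: e_indep;
  last exact: mem_tnth.
by move=> v /seq_tnthP[b ->]; rewrite -mulE xA0 mxE.
Qed.

Let A_rank : \rank A = size es.
Proof. by apply/eqP; apply: inj_row_free A_inj. Qed.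

Lemma equations_solutions_le m (phi : 'I_m -> U -> G) :
  (forall c : 'I_m -> G,
    {in us, forall v, \sum_i c i * phi i v = 0} -> forall i, c i = 0) ->
  {in es, forall t i, \sum_(v <- us) e t v * phi i v = 0} ->
  (size es + m <= size us)%N.
Proof.
move=> phi_indep phi_sol.
pose C : 'M[G]_(m, size us) := \matrix_(i, b) phi i (tnth (in_tuple us) b).
have rC : \rank C = m.
  apply/eqP; apply: inj_row_free => x xC0; apply/rowP => i; rewrite mxE.
  apply: (phi_indep (x 0)) => v /seq_tnthP[b ->].
  transitivity ((x *m C) 0 b); last by rewrite xC0 mxE.
  by rewrite mxE; apply: eq_bigr => j _; rewrite mxE.
rewrite -A_rank -[X in (_ + X)%N]rC -(mxrank_tr C); apply: mulmx0_rank_max.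
apply/matrixP => a i; rewrite !mxE.
rewrite -[RHS](phi_sol (tnth (in_tuple es) a) (mem_tnth _ _) i).
by rewrite [RHS]big_tnth; apply: eq_bigr => b _; rewrite !mxE.
Qed.

(** The unknowns outside a maximal set of independent columns can be given
    arbitrary values. *)
Lemma free_unknowns : uniq us -> exists B : seq U,
  [/\ uniq B, {subset B <= us}, size B = (size us - size es)%N &
   forall (c : T -> G) (x : U -> G),
   {in us, forall v,
     \sum_(t <- es) c t * e t v + (if v \in B then x v else 0) = 0} ->
   {in es, forall t, c t = 0}].
Proof.
move=> us_uniq; pose f := maxrankfun A^T.
have us_inj : injective (tnth (in_tuple us)) by apply/tuple_uniqP.
pose B := [seq tnth (in_tuple us) b | b <- enum 'I_(size us) & b \notin codom f].
exists B; split.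
- by rewrite map_inj_uniq // filter_uniq // enum_uniq.
- by move=> v /mapP[b _ ->]; exact: mem_tnth.
- have card_f : #|codom f| = size es.
    rewrite card_codom; last exact: maxrankfun_inj.
    by rewrite card_ord mxrank_tr A_rank.
  have cardB : size B = #|predC (mem (codom f))|.
    by rewrite size_map size_filter -sum1_count big_enum_cond /= sum1_card.
  have := cardC (mem (codom f)); rewrite -cardB [#|mem _|]card_f card_ord.
  move=> e_card; apply/esym/eqP; rewrite -(eqn_add2l (size es)).
  by rewrite subnKC ?e_card // -e_card leq_addr.
move=> c x rel; pose y : 'rV_(size es) := \row_a c (tnth (in_tuple es) a).
suff y0 : y = 0.
  move=> t /seq_tnthP[a ->].
  by have := congr1 (fun M : 'rV_ _ => M 0 a) y0; rewrite !mxE.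
apply: A_inj; apply: trmx_inj; rewrite trmx_mul trmx0.
have /submxP[M ->] : (A^T <= rowsub f A^T)%MS by rewrite eq_maxrowsub.
rewrite -mulmxA (_ : rowsub f A^T *m y^T = 0) ?mulmx0 //.
apply/colP => k; rewrite !mxE.
have := rel (tnth (in_tuple us) (f k)) (mem_tnth _ _).
rewrite ifN ?addr0 => [rel0|].
  apply: etrans rel0; rewrite [RHS]big_tnth.
  by apply: eq_bigr => a _; rewrite !mxE mulrC.
rewrite mem_map // mem_filter negb_and negbK; apply/orP; left; exact: codom_f.
Qed.

End FiniteSystems.

Section Boxes.

Variable n : nat.
Implicit Types (f : 'I_n -> nat) (r : nat).

(** The pairs of level at most r, the level of (i, k) being k - f i. *)
Definition box f r : seq ('I_n * nat) :=
  [seq (i, k) | i <- enum 'I_n, k <- iota 0 (f i + r).+1].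

Lemma mem_box f r i k : ((i, k) \in box f r) = (k <= f i + r)%N.
Proof.
apply/allpairsPdep/idP => [[j [l [_ + [-> ->]]]]|le_k].
  by rewrite mem_iota add0n ltnS.
by exists i, k; rewrite mem_enum mem_iota add0n ltnS.
Qed.

Lemma box_uniq f r : uniq (box f r).
Proof.
apply: allpairs_uniq_dep; rewrite ?enum_uniq //.
  by move=> i _; exact: iota_uniq.
by move=> [i k] [j l] _ _ /= [-> ->].
Qed.

Lemma size_box f r : size (box f r) = (\sum_i f i + n * r.+1)%N.
Proof.
rewrite size_allpairs_dep sumnE big_map big_enum /=.
under eq_bigr do rewrite size_iota -addnS.
by rewrite big_split /= sum_nat_const card_ord.
Qed.

End Boxes.

(** The column (j, k) of the matrix cf is the unknown x_j^(k), of level k - mu j,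
    and the row (i, l) is the l-th derivative of the i-th equation, of level
    l - la i. By cf_vanish and cf_top the matrix is block triangular with respect
    to the levels, with the same block Lam at every nonnegative level. Up to any
    such level there are sum(mu) - sum(la) more unknowns than equations. *)
Section LinearSystem.

Variables (G : fieldType) (n : nat) (la mu : 'I_n -> nat).
Variables (cf : 'I_n * nat -> 'I_n * nat -> G) (Lam : 'M[G]_n).

Hypothesis cf_indep : forall (s : seq ('I_n * nat)) (c : 'I_n * nat -> G),
  uniq s -> (forall v, \sum_(t <- s) c t * cf t v = 0) -> {in s, forall t, c t = 0}.
Hypothesis cf_vanish : forall i l j k,
  (mu j + l < k + la i)%N -> cf (i, l) (j, k) = 0.
Hypothesis cf_top : forall i l j k,
  (mu j + l = k + la i)%N -> cf (i, l) (j, k) = Lam i j.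

Lemma cf_out_box r t v : t \in box la r -> v \notin box mu r -> cf t v = 0.
Proof.
case: t v => i l [j k]; rewrite !mem_box -ltnNge => le_l lt_k.
by apply: cf_vanish; lia.
Qed.

Lemma box_indep r (c : 'I_n * nat -> G) :
  {in box mu r, forall v, \sum_(t <- box la r) c t * cf t v = 0} ->
  {in box la r, forall t, c t = 0}.
Proof.
move=> rel; apply: cf_indep (box_uniq _ _) _ => v.
have [/rel //|vout] := boolP (v \in box mu r).
by rewrite big_seq big1 // => t tin; rewrite (cf_out_box tin vout) mulr0.
Qed.

Lemma potentials_weak_duality : (\sum_i la i <= \sum_j mu j)%N.
Proof.
have := @equations_solutions_le _ _ _ _ (box mu 0) cf (box_uniq la 0)
  (box_indep (r := 0)) 0 (fun _ _ => 0).
rewrite !size_box addn0 leq_add2r; apply=> [c _ []|t _ []] //.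
Qed.

Section Solutions.

Variables (m r : nat) (phi : 'I_m -> 'I_n * nat -> G).
Hypothesis phi_indep : forall c : 'I_m -> G,
  {in box mu r, forall v, \sum_i c i * phi i v = 0} -> forall i, c i = 0.
Hypothesis phi_sol : {in box la r, forall t i,
  \sum_(v <- box mu r) cf t v * phi i v = 0}.

Lemma solutions_le : (m <= \sum_j mu j - \sum_i la i)%N.
Proof.
have := equations_solutions_le (box_uniq la r) (box_indep (r := r))
  phi_indep phi_sol.
by rewrite !size_box; lia.
Qed.

Hypothesis phi_solS : {in box la r.+1, forall t i,
  \sum_(v <- box mu r.+1) cf t v * phi i v = 0}.

(** If the matrix of leading coefficients is singular, a combination of the
    prolongations of the next level loses its top terms, and is one more
    equation between the unknowns of the present level. *)
Lemma solutions_lt : \det Lam = 0 -> (m < \sum_j mu j - \sum_i la i)%N.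
Proof.
move=> /eqP/det0P[u u0 uLam].
pose tops := [seq (i, (la i + r).+1) | i <- enum 'I_n].
(* None stands for the additional equation. *)
pose es := None :: map Some (box la r).
pose e o v := if o is Some t then cf t v
              else \sum_i u 0 i * cf (i, (la i + r).+1) v.
have eN_out v : v \notin box mu r -> e None v = 0.
  case: v => j k; rewrite mem_box -ltnNge leq_eqVlt => /orP[/eqP ek|lt_k].
    transitivity ((u *m Lam) 0 j); last by rewrite uLam mxE.
    rewrite mxE; apply: eq_bigr => i _.
    by rewrite -(@cf_top i (la i + r).+1 j k) //; lia.
  by rewrite /= big1 // => i _; rewrite cf_vanish ?mulr0 //; lia.
have es_uniq : uniq es.
  rewrite /= map_inj_uniq ?box_uniq ?andbT; last by move=> a b [].
  by apply/mapP => -[].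
have mem_tops t : t \in tops -> t.2 = (la t.1 + r).+1 by case/mapP => i _ ->.
have s_uniq : uniq (box la r ++ tops).
  rewrite cat_uniq box_uniq map_inj_uniq ?enum_uniq ?andbT; last by move=> i j [].
  apply/hasPn => -[i l] /mem_tops /= ->; by rewrite mem_box -ltnNge.
have e_indep (c : option ('I_n * nat) -> G) :
    {in box mu r, forall v, \sum_(o <- es) c o * e o v = 0} ->
    {in es, forall o, c o = 0}.
  move=> rel.
  pose c' t := if t \in box la r then c (Some t) else c None * u 0 t.1.
  have c'0 : {in box la r ++ tops, forall t, c' t = 0}.
    apply: (cf_indep s_uniq) => v.
    have e1 : \sum_(t <- box la r) c' t * cf t v =
              \sum_(t <- box la r) c (Some t) * e (Some t) v.
      by apply: eq_big_seq => t tin; rewrite /c' tin.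
    have e2 : \sum_(t <- tops) c' t * cf t v = c None * e None v.
      rewrite big_map big_enum /= mulr_sumr; apply: eq_bigr => i _.
      by rewrite /c' mem_box ltnn mulrA.
    rewrite big_cat /= e1 e2 addrC.
    have [vin|vout] := boolP (v \in box mu r).
      by have := rel v vin; rewrite big_cons big_map.
    rewrite eN_out // mulr0 add0r big_seq big1 // => t tin.
    by rewrite /= (cf_out_box tin vout) mulr0.
  move=> o; rewrite inE => /orP[/eqP->|/mapP[t tin ->]]; last first.
    have := c'0 t; rewrite mem_cat tin => /(_ isT).
    by rewrite /c' tin.
  apply/eqP; apply: contraNT u0 => c0; apply/eqP/rowP => i; rewrite mxE.
  have iin : (i, (la i + r).+1) \in tops by apply: map_f; rewrite mem_enum.
  have := c'0 (i, (la i + r).+1); rewrite mem_cat iin orbT /c' mem_box ltnn.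
  by move=> /(_ isT)/eqP; rewrite mulf_eq0 (negbTE c0) => /eqP.
have e_sol : {in es, forall o i, \sum_(v <- box mu r) e o v * phi i v = 0}.
  move=> o; rewrite inE => /orP[/eqP->|/mapP[t tin ->]] k; last exact: phi_sol.
  rewrite -(@big_seq_widen _ _ _ (box mu r.+1)) ?box_uniq //; last 2 first.
  - by case=> j l; rewrite !mem_box; lia.
  - by move=> v /eN_out->; rewrite mul0r.
  under eq_bigr do rewrite mulr_suml.
  rewrite exchange_big big1 //= => i _.
  under eq_bigr do rewrite -mulrA.
  by rewrite -mulr_sumr phi_solS ?mulr0 // mem_box addnS.
have := equations_solutions_le es_uniq e_indep phi_indep e_sol.
rewrite /es /= size_map !size_box.
by move: (\sum_i la i)%N (\sum_i mu i)%N (n * r.+1)%N; lia.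
Qed.

End Solutions.

(** If Lam is regular, the equations of positive level determine the unknowns
    of positive level, so the free unknowns are those left free by the
    equations of level zero. *)
Lemma free_box : \det Lam != 0 -> exists B : seq ('I_n * nat),
  [/\ uniq B, size B = (\sum_j mu j - \sum_i la i)%N &
   forall r (c x : 'I_n * nat -> G),
   (forall v,
     \sum_(t <- box la r) c t * cf t v + (if v \in B then x v else 0) = 0) ->
   {in box la r, forall t, c t = 0}].
Proof.
move=> Lam_reg.
have [B [uB subB sB freeB]] :=
  free_unknowns (box_uniq la 0) (box_indep (r := 0)) (box_uniq mu 0).
exists B; split=> //; first by rewrite sB !size_box subnDr.
elim=> [|r IH] c x rel; first by apply: (freeB c x) => v _; exact: rel.
pose y : 'rV[G]_n := \row_i c (i, (la i + r).+1).
have boxS : {subset box la r <= box la r.+1}.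
  by case=> i l; rewrite !mem_box; lia.
have c_top i : c (i, (la i + r).+1) = 0.
  suff y0 : y = 0 by have := congr1 (fun M : 'rV_ _ => M 0 i) y0; rewrite !mxE.
  have Lam_unit : Lam \in unitmx by rewrite unitmxE unitfE.
  rewrite -[y](mulmxK Lam_unit) (_ : y *m Lam = 0) ?mul0mx //.
  apply/rowP => j; rewrite !mxE.
  have jB : (j, (mu j + r).+1) \notin B.
    by apply/negP => /subB; rewrite mem_box; lia.
  have := rel (j, (mu j + r).+1); rewrite (negbTE jB) addr0 => rel0.
  apply: etrans rel0.
  rewrite [RHS](bigID (mem (box la r))) /=.
  rewrite [X in _ = X + _]big1_seq ?add0r; last first.
    case=> k l /andP[lin _]; rewrite cf_vanish ?mulr0 //.
    by move: lin; rewrite mem_box; lia.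
  rewrite -[RHS]big_filter.
  have perm_tops : perm_eq [seq t <- box la r.+1 | t \notin box la r]
                           [seq (k, (la k + r).+1) | k <- enum 'I_n].
    apply: uniq_perm; rewrite ?filter_uniq ?box_uniq //.
      by rewrite map_inj_uniq ?enum_uniq // => i1 i2 [].
    case=> k l; rewrite mem_filter !mem_box.
    apply/andP/mapP => [[gt_l le_l]|[k' _ [-> ->]]]; last by lia.
    by exists k; rewrite ?mem_enum //; congr (_, _); lia.
  rewrite [RHS](perm_big _ perm_tops) big_map big_enum /=.
  by apply: eq_bigr => k _; rewrite mxE (@cf_top _ _ j) //; lia.
pose c' t := if t \in box la r.+1 then c t else 0.
have c'_low : {in box la r, forall t, c' t = 0}.
  apply: (IH c' x) => v; rewrite -[RHS](rel v); congr (_ + _).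
  transitivity (\sum_(t <- box la r.+1) c' t * cf t v).
    apply/esym/big_seq_widen; rewrite ?box_uniq // => -[i l] nin; rewrite /c'.
    case: ifP => [|_]; last by rewrite mul0r.
    move: nin; rewrite !mem_box -ltnNge => lt_l le_l.
    by rewrite (_ : l = (la i + r).+1) ?c_top ?mul0r //; lia.
  by apply: eq_big_seq => t tin; rewrite /c' tin.
case=> i l; rewrite mem_box leq_eqVlt addnS ltnS => /orP[/eqP->|le_l].
  exact: c_top.
by have := c'_low (i, l); rewrite /c' !mem_box le_l addnS leqW // => ->.
Qed.

End LinearSystem.

(** * Algebraic independence and the linearised system *)

Section Independence.

Variables (F : fieldType) (n : nat) (G : fieldType).
Variable pi : {rmorphism dpoly F n -> G}.
Hypothesis charF : [pchar F] =i pred0.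

Definition residue_const : {rmorphism F -> G} := pi \o @pconst F (dvar n).

Lemma residue_char0 : [pchar G] =i pred0.
Proof. by move=> p; rewrite (fmorph_pchar residue_const) charF. Qed.

Lemma residue_peval (Q : dpoly F n) :
  pi Q = peval residue_const (fun v => pi (pvar F v)) Q.
Proof. exact: rmorph_peval. Qed.

Lemma dpair_along phi : derivation_along pi (dpair pi phi).
Proof.
exact: (gradient_along pi phi (@pvars_uniq F (dvar n)) (@pderiv_out F (dvar n))
  (@pderiv_derivation F (dvar n))).
Qed.

Lemma dpairC phi c : dpair pi phi (@pconst F (dvar n) c) = 0.
Proof. by apply: big1 => v _; rewrite pderivC rmorph0 mul0r. Qed.

Lemma dpairX phi w : dpair pi phi (pvar F w) = phi w.
Proof.
rewrite (@dpair_widen _ _ _ _ phi (pvar F w) [:: w]) //.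
  by rewrite big_seq1 pderivX eqxx rmorph1 mul1r.
by move=> v; rewrite inE pderivX eq_sym => /negbTE->; rewrite rmorph0.
Qed.

(** The derivations of F(t) with respect to the t_i extend to any finitely
    generated extension; on a residue field generated by the classes of the
    variables they are independent solutions of the linearised equations. *)
Lemma alg_indep_solutions m (t : 'I_m -> G) :
  (forall g, exists Q1 Q2, pi Q2 != 0 /\ g = pi Q1 / pi Q2) ->
  alg_indep residue_const t ->
  exists W0 : seq (dvar n), forall W : seq (dvar n), {subset W0 <= W} ->
  exists phi : 'I_m -> dvar n -> G,
    (forall i Q, pi Q = 0 -> {subset pvars Q <= W} -> dpair pi (phi i) Q = 0) /\
    (forall c : 'I_m -> G,
      {in W0, forall v, \sum_i c i * phi i v = 0} -> forall i, c i = 0).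
Proof.
move=> frac t_indep.
pose num k := projT1 (cid (frac (t k))).
pose den k := projT1 (cid (projT2 (cid (frac (t k))))).
have fracP k : pi (den k) != 0 /\ t k = pi (num k) / pi (den k).
  exact: (projT2 (cid (projT2 (cid (frac (t k)))))).
pose W0 := flatten [seq pvars (num k) ++ pvars (den k) | k <- enum 'I_m].
have numW k : {subset pvars (num k) <= W0}.
  move=> v vk; apply/flatten_mapP; exists k; first by rewrite mem_enum.
  by rewrite mem_cat vk.
have denW k : {subset pvars (den k) <= W0}.
  move=> v vk; apply/flatten_mapP; exists k; first by rewrite mem_enum.
  by rewrite mem_cat vk orbT.
exists W0 => W W0W.
pose A0 := polyring F 'I_m.
pose h0 : {rmorphism A0 -> G} := peval residue_const t.
pose D0 i (p : A0) := h0 (pderiv i p).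
have D0_der i : derivation_along h0 (D0 i).
  split=> p q.
    exact: etrans (congr1 h0 (pderivD i p q)) (rmorphD h0 _ _).
  apply: (etrans (congr1 h0 (pderivM i p q))); apply: (etrans (rmorphD h0 _ _)).
  have hM := rmorphM h0.
  by apply: (etrans (congr2 (fun x y => x + y) (hM _ _) (hM _ _))).
have D0_ker i (p : A0) : h0 p = 0 -> D0 i p = 0.
  move=> /t_indep p0.
  exact: etrans (congr1 (D0 i) p0) (derivation_along0 (D0_der i)).
have D0C i c : D0 i (pconst _ c) = 0.
  exact: etrans (congr1 h0 (pderivC i c)) (rmorph0 h0).
have D0X i k : D0 i (pvar F k) = (k == i)%:R.
  exact: etrans (congr1 h0 (pderivX _ i k)) (rmorph_nat h0 _).
have [A [j [h [D [Dder Dker hj Dj lifts]]]]] :=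
  extend_derivations [seq pi (pvar F v) | v <- W] residue_char0 D0_der D0_ker.
have lift_ex v : exists a, v \in W -> h a = pi (pvar F v).
  have [vW|_] := boolP (v \in W); last by exists 0.
  by have [a ha] := lifts _ (map_f _ vW); exists a.
pose lift v := projT1 (cid (lift_ex v)).
have liftP v : v \in W -> h (lift v) = pi (pvar F v) := projT2 (cid (lift_ex v)).
pose iA : {rmorphism F -> A} := j \o @pconst F 'I_m.
pose Ev : {rmorphism dpoly F n -> A} := peval iA lift.
have EvC c : Ev (@pconst F (dvar n) c) = j (@pconst F 'I_m c) by exact: pevalC.
have EvX v : Ev (pvar F v) = lift v by exact: pevalX.
have hEv Q : {subset pvars Q <= W} -> h (Ev Q) = pi Q.
  move=> QW; have e1 : h (Ev Q) = peval residue_const (h \o lift) Q.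
    apply: (rmorph_peval (h := (h \o Ev))) => [c|v].
      apply: (etrans (congr1 h (EvC c))); apply: (etrans (hj _)).
      exact: pevalC.
    by apply: (etrans (congr1 h (EvX v))).
  rewrite e1 residue_peval; apply: eq_peval => v /QW vW.
  exact: liftP.
pose phi i v := D i (lift v).
have DEv i Q : {subset pvars Q <= W} -> D i (Ev Q) = dpair pi (phi i) Q.
  move=> QW; have [DD DM] := Dder i.
  have e1 := @chain_rule F (dvar n) G (h \o Ev) (fun Q => D i (Ev Q)).
  rewrite e1 => [|c|p q|p q].
  - rewrite /dpair; apply: eq_bigr => v _.
    have e2 : h (Ev (pderiv v Q)) = pi (pderiv v Q).
      by apply: hEv => w /pvars_pderiv; exact: QW.
    by apply: (etrans (congr2 (fun x y => x * y) e2 (congr1 (D i) (EvX v)))).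
  - exact: etrans (congr1 (D i) (EvC c)) (etrans (Dj i _) (D0C i c)).
  - exact: etrans (congr1 (D i) (rmorphD Ev p q)) (DD _ _).
  - exact: etrans (congr1 (D i) (rmorphM Ev p q)) (DM _ _).
exists phi; split=> [i Q Q0 QW|c crel k].
  by rewrite -DEv // Dker // hEv.
have lin0 Q : {subset pvars Q <= W0} -> \sum_i c i * D i (Ev Q) = 0.
  move=> QW0; have QW : {subset pvars Q <= W} by move=> v /QW0; exact: W0W.
  under eq_bigr do rewrite DEv // /dpair mulr_sumr.
  rewrite exchange_big big_seq big1 //= => v vQ.
  under eq_bigr do rewrite mulrCA.
  by rewrite -mulr_sumr crel ?mulr0 //; exact: QW0.
have [den0 tk] := fracP k.
have numE : h (Ev (num k)) = pi (num k) by apply: hEv => v /numW; exact: W0W.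
have denE : h (Ev (den k)) = pi (den k) by apply: hEv => v /denW; exact: W0W.
move: (lin0 _ (numW k)) (lin0 _ (denW k)).
move: (Ev (num k)) (Ev (den k)) numE denE.
move=> a b ha hb a0 b0; pose tau := j (pvar F k).
have htau : h tau = t k by apply: (etrans (hj _)); exact: pevalX.
have Dtau i : D i tau = (k == i)%:R by exact: etrans (Dj i _) (D0X i k).
have rel i : D i tau * h b + h tau * D i b - D i a = 0.
  have [DD DM] := Dder i; rewrite -DM -(derivation_alongN (Dder i)) -DD Dker //.
  by rewrite rmorphB rmorphM htau ha hb tk divfK // subrr.
have : \sum_i c i * (D i tau * h b + h tau * D i b - D i a) = 0.
  by rewrite big1 // => i _; rewrite rel mulr0.
under eq_bigr do rewrite mulrBr mulrDr mulrCA [c _ * (h tau * _)]mulrCA.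
rewrite sumrB a0 subr0 big_split /= -mulr_sumr b0 mulr0 addr0.
rewrite (bigD1 k) //= big1 ?addr0 => [|i ik]; last first.
  by rewrite Dtau eq_sym (negbTE ik) mul0r.
rewrite Dtau eqxx mul1r hb => /eqP.
by rewrite mulf_eq0 (negbTE den0) orbF => /eqP.
Qed.

(** A relation of least degree between the t_b would have partial derivatives
    that are again relations, hence zero, and would be constant. *)
Lemma alg_indep_of_derivatives m (t : 'I_m -> G) :
  (forall p : polyring F 'I_m, peval residue_const t p = 0 ->
     forall b, peval residue_const t (pderiv b p) = 0) ->
  alg_indep residue_const t.
Proof.
move=> closed; suff gen N (p : polyring F 'I_m) :
    (forall mn, mcoeff mn p != 0 -> (mdeg mn < N)%N) ->
    peval residue_const t p = 0 -> p = 0.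
  move=> p; apply: (gen (msize p)) => mn; rewrite mcoeff_neq0.
  exact: msize_mdeg_lt.
elim: N p => [|N IH] p degp p0.
  apply/malgP=> mn; rewrite mcoeff0; apply/eqP/negPn/negP => /degp.
  by rewrite ltn0.
have dp0 b : pderiv b p = 0.
  apply: IH; last exact: closed.
  move=> mn; rewrite mcoeff_pderiv => c0.
  have : mcoeff (mmul mn (ucm b)) p != 0.
    by apply: contraNneq c0 => ->; rewrite mul0rn.
  by move/degp; rewrite mdegM mdegU addn1 ltnS.
have pC : p = pconst _ (mcoeff mone p).
  apply/malgP=> mn; apply: (etrans _ (esym (mcoeffU _ _ _))).
  have [<-|mn1] := eqVneq mone mn; first by rewrite mulr1n.
  rewrite mulr0n; have [b bmn] : exists b, mn b != 0%N.
    have [m0|[v]] := fset_0Vmem (finsupp (cmonom_val mn)).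
      case/eqP: mn1; apply/esym/mdeg_eq0I; by rewrite mdegE m0 big_seq_fset0.
    by rewrite -cmE_neq0; exists v.
  have := mcoeff_pderiv b p (divcm mn (ucm b)).
  rewrite dp0 mcoeff0 mulcm_divcm // => /esym/eqP.
  rewrite -mulr_natr mulf_eq0 (proj1 (pcharf0P F) charF) orbF.
  by move/eqP.
have c0 : residue_const (mcoeff mone p) = 0.
  rewrite -[RHS]p0 pC; apply: (etrans _ (esym (pevalC _ _ _))).
  by congr (residue_const _); rewrite -pC.
rewrite pC; move: c0 => /eqP; rewrite fmorph_eq0 => /eqP->.
exact: rmorph0.
Qed.

End Independence.

(** * Jacobi's bound *)

Lemma supremum_nat (S : set nat) (N : nat) : (forall k, S k -> (k <= N)%N) ->
  (S = set0 /\ supremum -oo%E [set (k%:Z)%:E | k in S]%classic = -oo%E) \/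
  exists M : nat, [/\ S M, (forall k, S k -> (k <= M)%N) &
    supremum -oo%E [set (k%:Z)%:E | k in S]%classic = (M%:Z)%:E].
Proof.
move=> SN; have [[k0 Sk0]|noS] := pselect (exists k, S k); last first.
  have S0 : S = set0 by apply/seteqP; split=> // k Sk; case: noS; exists k.
  by left; rewrite S0 image_set0 supremum0.
right; pose Q k := `[< S k >].
have exQ : exists k, Q k by exists k0; apply/asboolP.
have QN k : Q k -> (k <= N)%N by move/asboolP; exact: SN.
have [M /asboolP SM maxM] := ex_maxnP exQ QN.
have {}maxM k : S k -> (k <= M)%N by move=> Sk; apply: maxM; apply/asboolP.
exists M; split=> //; set A := (X in supremum _ X).
have supM : supremums A ((M%:Z)%:E).
  split; first by move=> _ [k Sk <-]; rewrite lee_fin lez_nat; exact: maxM.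
  by move=> y; apply; exists M.
rewrite /supremum ifF; last first.
  by apply/eqP => A0; have : A ((M%:Z)%:E) by [exists M]; rewrite A0.
exact: (xget_subset1 _ supM (@is_subset1_supremums _ _ A)).
Qed.

Lemma sum_ereal_le_eq (I : finType) (y : I -> \bar int) (x : I -> int) :
  (forall i, (y i <= (x i)%:E)%E) -> (\sum_i y i = (\sum_i x i)%:E)%E ->
  forall i, y i = (x i)%:E.
Proof.
move=> le_yx sum_eq.
have y_fin i : y i \is a fin_num.
  rewrite fin_numE; apply/andP; split; apply/eqP => yi; last first.
    by have := le_yx i; rewrite yi.
  have : (\sum_i y i = -oo)%E by apply/esum_eqNyP; exists i; rewrite mem_index_enum.
  by rewrite sum_eq.
have le_fine i : fine (y i) <= x i by rewrite -lee_fin fineK.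
move: sum_eq; rewrite -EFin_sum_fine // => -[/eqP].
rewrite eq_sym -subr_eq0 -sumrB => /eqP sum0 i.
have nonneg k : true -> 0 <= x k - fine (y k) by rewrite subr_ge0.
have /eqP : x i - fine (y i) = 0 := psumr_eq0P nonneg sum0 isT.
by rewrite subr_eq0 => /eqP->; rewrite fineK.
Qed.

Lemma sum_mul_eq (A : pzRingType) (I : eqType) (s : seq I) (f : I -> A) b :
  uniq s -> (b \notin s -> f b = 0) -> \sum_(a <- s) f a * (a == b)%:R = f b.
Proof.
move=> us out; have [bs|/out fb] := boolP (b \in s).
  rewrite (bigD1_seq b) //= eqxx mulr1 big1 ?addr0 // => a /negbTE->.
  by rewrite mulr0.
rewrite fb big1 // => a _; case: eqP => [->|_]; last by rewrite mulr0.
by rewrite fb mul0r.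
Qed.

Section JacobiBound.

Variables (F : fieldType) (d : F -> F) (n : nat) (P : 'I_n -> dpoly F n).
Variables (PP : set (dpoly F n)) (G : fieldType) (dG : G -> G).
Variable pi : {rmorphism dpoly F n -> G}.
Hypothesis charF : [pchar F] =i pred0.
Hypothesis d_der : is_derivation d.
Hypothesis PP_comp : is_component d P PP.
Hypothesis pi_res : is_residue_diff_field d PP dG pi.
Hypothesis sqr : strongly_quasi_regular dG pi P.

Definition lin_coef (t v : 'I_n * nat) : G :=
  pi (pderiv (v : dvar n) (prolongation d P t.1 t.2)).

Local Notation cf := lin_coef.

Let pi_ker Q : pi Q = 0 <-> PP Q.
Proof. by case: pi_res. Qed.

Let dG_der : is_derivation dG.
Proof. by case: pi_res. Qed.

Let pi_delta Q : dG (pi Q) = pi (delta d Q).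
Proof. by case: pi_res. Qed.

Lemma lin_coef0 i l j : cf (i, l.+1) (j, 0%N) = dG (cf (i, l) (j, 0%N)).
Proof.
exact: etrans (congr1 pi (pderiv_delta0 d_der j (prolongation d P i l)))
              (esym (pi_delta _)).
Qed.

Lemma lin_coefS i l j k :
  cf (i, l.+1) (j, k.+1) = dG (cf (i, l) (j, k.+1)) + cf (i, l) (j, k).
Proof.
apply: (etrans (congr1 pi (pderiv_deltaS d_der j k (prolongation d P i l)))).
apply: (etrans (rmorphD pi _ _)).
exact: (congr1 (fun x => x + _) (esym (pi_delta _))).
Qed.

Lemma lin_coef_indep (s : seq ('I_n * nat)) (c : 'I_n * nat -> G) : uniq s ->
  (forall v, \sum_(t <- s) c t * cf t v = 0) -> {in s, forall t, c t = 0}.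
Proof.
move=> us rel; apply: (sqr us); apply/malgP => v.
rewrite mcoeff0 -[RHS](rel v) raddf_sum /=; apply: eq_bigr => t _.
rewrite mcoeffZ; congr (_ * _).
apply: (etrans (congr1 (mcoeff v) (prolongation_form P d_der pi_res t.1 t.2))).
exact: mcoeff_dform.
Qed.

Section Potential.

Variables la mu : 'I_n -> nat.
Hypothesis feas : feasible (fun i j k => cf (i, 0%N) (j, k) != 0) la mu.

Lemma lin_coef_vanish i l j k : (mu j + l < k + la i)%N -> cf (i, l) (j, k) = 0.
Proof.
elim: l j k => [|l IH] j k lt_k.
  apply/eqP; apply: contraLR lt_k => /feas; rewrite addn0 -leqNgt; exact.
case: k lt_k => [|k] lt_k.
  by rewrite lin_coef0 IH ?(derivation0 dG_der) //; lia.
by rewrite lin_coefS !IH ?(derivation0 dG_der) ?addr0 //; lia.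
Qed.

Definition leading_mx : 'M[G]_n := \matrix_(i, j)
  if (la i <= mu j)%N then cf (i, 0%N) (j, (mu j - la i)%N) else 0.

(** Differentiating an equation and raising the order of the unknown does not
    change the leading coefficients: every level carries the same block. *)
Lemma lin_coef_top i l j k :
  (mu j + l = k + la i)%N -> cf (i, l) (j, k) = leading_mx i j.
Proof.
elim: l k => [|l IH] k; rewrite mxE.
  by rewrite addn0 => ->; rewrite leq_addl addnK.
case: k => [|k] ek.
  rewrite lin_coef0 lin_coef_vanish ?(derivation0 dG_der); last by lia.
  by case: ifP => //; lia.
rewrite lin_coefS lin_coef_vanish ?(derivation0 dG_der) ?add0r; last by lia.
by rewrite IH ?mxE //; lia.
Qed.

Lemma value_ge0 : (\sum_i la i <= \sum_j mu j)%N.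
Proof. exact: potentials_weak_duality lin_coef_indep lin_coef_vanish. Qed.

Local Notation O := (\sum_j mu j - \sum_i la i)%N.

Lemma alg_indep_le m (t : 'I_m -> G) : alg_indep (residue_const pi) t ->
  (m <= O)%N /\ (\det leading_mx = 0 -> (m < O)%N).
Proof.
move=> t_indep; have frac : forall g, exists Q1 Q2, pi Q2 != 0 /\ g = pi Q1 / pi Q2.
  by case: pi_res.
have [W0 W0P] := alg_indep_solutions charF frac t_indep.
(* Level r is enough to separate the solutions. All the variables of the
   prolongations enter W, even those whose partial derivative is zero in G. *)
pose r := \max_(v <- W0) v.2.
have W0r : {subset W0 <= box mu r}.
  case=> j k vW; rewrite mem_box (leq_trans _ (leq_addl _ _)) //.
  exact: (@leq_bigmax_seq _ W0 xpredT (fun v => v.2) (j, k)).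
pose W : seq (dvar n) := W0 ++ box mu r.+1 ++
  flatten [seq pvars (prolongation d P t.1 t.2) | t <- box la r.+1].
have W0W : {subset W0 <= W} by move=> v vW; rewrite mem_cat vW.
have [phi [phi_sol phi_indep]] := W0P W W0W.
have sol r' : (r' <= r.+1)%N -> {in box la r', forall t i,
    \sum_(v <- box mu r') cf t v * phi i v = 0}.
  move=> le_r [i0 l] tin i.
  have sub : {subset pvars (prolongation d P i0 l) <= W}.
    move=> v vP; rewrite !mem_cat; apply/orP; right; apply/orP; right.
    apply/flatten_mapP; exists (i0, l) => //.
    by move: tin; rewrite !mem_box; lia.
  have p0 : pi (prolongation d P i0 l) = 0.
    by apply/pi_ker; exact: prolongation_in_component PP_comp i0 l.
  rewrite -[RHS](phi_sol i _ p0 sub); apply/esym/dpair_widen; first exact: box_uniq.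
  by move=> v; exact: (cf_out_box lin_coef_vanish tin).
have indep c : {in box mu r, forall v, \sum_i c i * phi i v = 0} ->
    forall i, c i = 0.
  by move=> rel; apply: phi_indep => v /W0r; exact: rel.
split=> [|det0].
  exact: (solutions_le lin_coef_indep lin_coef_vanish indep (sol r (leqnSn r))).
exact: (solutions_lt lin_coef_indep lin_coef_vanish lin_coef_top indep
          (sol r (leqnSn r)) (sol _ (leqnn _)) det0).
Qed.

(** Solutions can be prescribed on the free unknowns B, and all of them are
    tangent to the component: so the partial derivatives of a relation between
    the classes of these unknowns are again relations. *)
Lemma alg_indep_exists : \det leading_mx != 0 ->
  exists t : 'I_O -> G, alg_indep (residue_const pi) t.
Proof.
move=> det0; have [B [uB sB freeB]] :=
  free_box lin_coef_indep lin_coef_vanish lin_coef_top det0.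
rewrite -sB; pose x := tnth (in_tuple B).
have x_inj : injective x by apply/tuple_uniqP.
exists (fun b => pi (pvar F (x b : dvar n))).
pose e (o : 'I_n * nat + 'I_(size B)) : dmodule G n := match o with
  | inl t => dform pi (prolongation d P t.1 t.2)
  | inr b => mkmalgU (x b : dvar n) 1
  end.
have e_indep : lin_indep e.
  move=> s c us rel.
  pose r := \max_(o <- s) if o is inl t then t.2 else 0%N.
  have s_le t : inl t \in s -> t \in box la r.
    case: t => i l tin; rewrite mem_box (leq_trans _ (leq_addl _ _)) //.
    exact: (@leq_bigmax_seq _ s xpredT
      (fun o => if o is inl t then t.2 else 0%N) (inl (i, l))).
  pose c1 t := if inl t \in s then c (inl t) else 0.
  pose c2 b := if inr b \in s then c (inr b) else 0.
  pose y v := \sum_(b | x b == v) c2 b.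
  have rel' v : \sum_(t <- box la r) c1 t * cf t v +
      (if v \in B then y v else 0) = 0.
    pose S := map inl (box la r) ++ map inr (enum 'I_(size B)) :
      seq ('I_n * nat + 'I_(size B)).
    have uS : uniq S.
      have inl_inj : injective (@inl ('I_n * nat) 'I_(size B)) by move=> a b [].
      have inr_inj : injective (@inr ('I_n * nat) 'I_(size B)) by move=> a b [].
      rewrite cat_uniq (map_inj_uniq inl_inj) (map_inj_uniq inr_inj).
      rewrite box_uniq enum_uniq andbT /=.
      by apply/hasPn => _ /mapP[b _ ->]; apply/mapP => -[].
    have sS : {subset s <= S}.
      case=> [t|b] os; rewrite mem_cat; apply/orP.
        by left; apply: map_f; exact: s_le.
      by right; apply: map_f; rewrite mem_enum.
    have := congr1 (mcoeff v) rel; rewrite mcoeff0 raddf_sum /= => rel_v.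
    transitivity (\sum_(o <- S) if o \in s then mcoeff v (c o *: e o) else 0).
      rewrite big_cat [X in _ = X + _]big_map [X in _ = _ + X]big_map.
      congr (_ + _).
        apply: eq_bigr => t _; rewrite /c1; case: ifP => _; last by rewrite mul0r.
        by rewrite mcoeffZ; congr (_ * _); apply/esym; exact: mcoeff_dform.
      transitivity (y v).
        case: ifP => // /negbT vB; rewrite /y big1 // => b /eqP xbv.
        by move: vB; rewrite -xbv mem_tnth.
      rewrite /y [LHS]big_mkcond [RHS]big_enum /=.
      apply: eq_bigr => b _; rewrite /c2.
      case: ifP => xbv; case: ifP => // _.
        by rewrite mcoeffZ mcoeffU xbv mulr1n mulr1.
      by rewrite mcoeffZ mcoeffU xbv mulr0n mulr0.
    rewrite (big_seq_widen us uS sS) => [|o /negbTE-> //].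
    by rewrite -[RHS]rel_v; apply: eq_big_seq => o ->.
  have c1_0 := freeB r c1 y rel'.
  case=> [t|b] os.
    by have := c1_0 t (s_le t os); rewrite /c1 os.
  have xB : x b \in B by exact: mem_tnth.
  have := rel' (x b); rewrite xB big_seq big1 ?add0r => [|t tin]; last first.
    by rewrite c1_0 ?mul0r.
  rewrite /y (big_pred1 b) => [|b' /=]; last by rewrite (inj_eq x_inj).
  by rewrite /c2 os.
have sol b0 : exists phi : dvar n -> G,
    (forall Q, PP Q -> dpair pi phi Q = 0) /\ forall b, phi (x b) = (b == b0)%:R.
  have [phi [phi1 phi2]] := @form_solution F n G pi _ e
    (fun o => if o is inr b then (b == b0)%:R else 0) e_indep.
  exists phi; split=> [Q PPQ|b]; last exact: (phi2 (inr b)).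
  apply: (solution_tangent charF d_der PP_comp pi_res sqr) => // i l.
  exact: (phi1 (inl (i, l))).
apply: (alg_indep_of_derivatives charF) => p p0 b0.
have [phi [phi_tan phiB]] := sol b0.
pose emb : {rmorphism polyring F 'I_(size B) -> dpoly F n} :=
  peval (@pconst F (dvar n)) (fun b => pvar F (x b : dvar n)).
have embC c : emb (pconst _ c) = pconst _ c by exact: pevalC.
have embX b : emb (pvar F b) = pvar F (x b : dvar n) by exact: pevalX.
have pi_emb q : pi (emb q) =
    peval (residue_const pi) (fun b => pi (pvar F (x b : dvar n))) q.
  apply: (rmorph_peval (h := (pi \o emb))) => [c|b].
    exact: (congr1 pi (embC c)).
  exact: (congr1 pi (embX b)).
have emb0 : dpair pi phi (emb p) = 0.
  by apply: phi_tan; apply/pi_ker; rewrite pi_emb.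
have [DD DM] := dpair_along pi phi.
have DC c : dpair pi phi (emb (pconst _ c)) = 0.
  by apply: (etrans (congr1 (dpair pi phi) (embC c))); exact: dpairC.
have DX b : dpair pi phi (emb (pvar F b)) = (b == b0)%:R.
  apply: (etrans (congr1 (dpair pi phi) (embX b))); apply: (etrans (dpairX _ _ _)).
  exact: phiB.
have e1 := @chain_rule F 'I_(size B) G (pi \o emb)
  (fun q => dpair pi phi (emb q)) DC
  (fun q1 q2 => etrans (congr1 (dpair pi phi) (rmorphD emb q1 q2)) (DD _ _))
  (fun q1 q2 => etrans (congr1 (dpair pi phi) (rmorphM emb q1 q2)) (DM _ _)) p.
have e2 : \sum_(b <- pvars p)
            (pi \o emb) (pderiv b p) * dpair pi phi (emb (pvar F b)) =
          \sum_(b <- pvars p) (pi \o emb) (pderiv b p) * (b == b0)%:R.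
  by apply: eq_bigr => b _; exact: (congr1 (fun z => _ * z) (DX b)).
have e3 : \sum_(b <- pvars p) (pi \o emb) (pderiv b p) * (b == b0)%:R =
          pi (emb (pderiv b0 p)) :=
  sum_mul_eq (pvars_uniq p) (f := fun b => (pi \o emb) (pderiv b p))
  (fun nb => etrans (congr1 (pi \o emb) (pderiv_out nb)) (rmorph0 (pi \o emb))).
apply: (etrans (esym (pi_emb _))); apply: (etrans (esym e3)).
exact: etrans (esym e2) (etrans (esym e1) emb0).
Qed.

End Potential.

Lemma feasible_exists : exists la mu,
  feasible (fun i j k => cf (i, 0%N) (j, k) != 0) la mu.
Proof.
exists (fun=> 0%N), (fun=> \max_i \max_(v <- pvars (P i)) v.2) => i j k c0.
have vP : ((j, k) : dvar n) \in pvars (P i).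
  apply: mem_pvars; apply: contraNneq c0 => e.
  by apply/eqP; exact: etrans (congr1 pi e) (rmorph0 pi).
rewrite addn0; apply: (leq_trans _ (leq_bigmax i)).
exact: (@leq_bigmax_seq _ (pvars (P i)) xpredT (fun v : dvar n => v.2) (j, k)).
Qed.

Section Optimal.

Variables (la mu : 'I_n -> nat) (s0 : 'S_n).
Hypothesis feas : feasible (fun i j k => cf (i, 0%N) (j, k) != 0) la mu.
Hypothesis tight_s0 : forall i,
  tight (fun i j k => cf (i, 0%N) (j, k) != 0) la mu i (s0 i).

Local Notation O := (\sum_j mu j - \sum_i la i)%N.
Local Notation Lam := (leading_mx la mu).

(** The potentials bound the orders of the equations, and leading_mx has a
    nonzero entry exactly where the bound is attained. *)
Lemma aordP i j :
  (aord P PP i j <= ((mu j)%:Z - (la i)%:Z)%:E)%E /\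
  (aord P PP i j = ((mu j)%:Z - (la i)%:Z)%:E <-> Lam i j != 0).
Proof.
pose S := [set k : nat | ~ PP (pderiv ((j, k) : dvar n) (P i))]%classic.
have S_cf k : S k <-> cf (i, 0%N) (j, k) != 0.
  split=> [nP|/eqP c0 /pi_ker //].
  by apply/eqP => /pi_ker.
have S_le k : S k -> (k <= mu j - la i)%N.
  by move=> /S_cf/feas le_k; lia.
have LamE : Lam i j != 0 <-> (la i <= mu j)%N /\ S (mu j - la i)%N.
  rewrite mxE; case: ifP => le_ij; last by split=> [|[]//]; rewrite eqxx.
  by split=> [/S_cf|[_ /S_cf]].
have -> : aord P PP i j = supremum -oo%E [set (k%:Z)%:E | k in S]%classic by [].
have [[S0 ->]|[M [SM maxM ->]]] := supremum_nat S_le.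
  by split; [exact: leNye|split=> // /LamE[_]; rewrite S0].
have le_M : (M + la i <= mu j)%N by apply: feas; apply/S_cf.
split; first by rewrite lee_fin; lia.
split=> [[e]|/LamE[le_ij /maxM le_muM]].
  have eM : M = (mu j - la i)%N by lia.
  by apply/LamE; rewrite -eM; split=> //; lia.
by congr (_%:E)%E; lia.
Qed.

Lemma sum_weights (s : 'S_n) :
  \sum_i ((mu (s i))%:Z - (la i)%:Z) = O%:Z.
Proof.
rewrite sumrB -subzn; last exact: value_ge0 feas.
have sumZ (f : 'I_n -> nat) : (\sum_i f i)%N%:Z = \sum_i (f i)%:Z.
  exact: (big_morph Posz PoszD (erefl _)).
by rewrite !sumZ [in RHS](reindex_inj (@perm_inj _ s)).
Qed.

Lemma jacobi_number_value : jacobi_number P PP = (O%:Z)%:E.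
Proof.
have le_sum (s : 'S_n) : (\sum_(i < n) aord P PP i (s i) <= (O%:Z)%:E)%E.
  rewrite -(sum_weights s) -sumEFin; apply: lee_sum => i _.
  by case: (aordP i (s i)).
apply/eqP; rewrite eq_le; apply/andP; split.
  by apply/bigmax_leP; split=> // s _; exact: le_sum.
apply: (@le_trans _ _ (\sum_(i < n) aord P PP i (s0 i))%E); last first.
  exact: (le_bigmax _ (fun s : 'S_n => (\sum_(i < n) aord P PP i (s i))%E) s0).
rewrite -(sum_weights s0) -sumEFin; apply: lee_sum => i _.
have [_ [_ e]] := aordP i (s0 i); rewrite e //.
by rewrite mxE; have := tight_s0 i; rewrite /tight => /andP[-> ].
Qed.

(** The system determinant is the Leibniz expansion of det Lam without the terms
    that have a zero factor. *)
Lemma system_det_value : pi (system_det P PP) = \det Lam.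
Proof.
have critical (s : 'S_n) :
    ((\sum_(i < n) aord P PP i (s i))%E == jacobi_number P PP) =
    [forall i, Lam i (s i) != 0].
  rewrite jacobi_number_value -(sum_weights s); apply/eqP/forallP => [e i|L0].
    apply/(aordP i (s i)).2; apply: (sum_ereal_le_eq _ e) => k.
    exact: (aordP k (s k)).1.
  by rewrite -sumEFin; apply: eq_bigr => i _; apply/(aordP i (s i)).2.
rewrite /system_det rmorph_sum big_mkcond; apply: eq_bigr => s _ /=.
rewrite critical; case: forallP => [L0|nL]; last first.
  have [i Li] : exists i, Lam i (s i) = 0.
    apply: contrapT => nE; apply: nL => i; apply/eqP => Li; apply: nE.
    by exists i.
  by rewrite (bigD1 i) //= Li mul0r mulr0.
rewrite rmorphM rmorph_prod rmorphXn rmorphN1; congr (_ * _).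
apply: eq_bigr => i _; have /(aordP i (s i)).2 -> := L0 i.
have := L0 i; rewrite mxE; case: ifP => [le_ij _|_]; last by rewrite eqxx.
rewrite subzn //=.
Qed.

End Optimal.

End JacobiBound.

Theorem theorem94 (F : fieldType) (d : F -> F) (n : nat)
    (P : 'I_n -> dpoly F n) (PP : set (dpoly F n))
    (G : fieldType) (dG : G -> G)
    (pi : {rmorphism dpoly F n -> G}) :
  [pchar F]%R =i pred0 ->
  is_derivation d ->
  is_component d P PP ->
  is_residue_diff_field d PP dG pi ->
  strongly_quasi_regular dG pi P ->
  (component_order pi <= jacobi_number P PP)%E /\
  (component_order pi = jacobi_number P PP <-> ~ PP (system_det P PP)).
Proof.
move=> charF d_der PP_comp pi_res sqr.
have [la [mu [feas [s0 tight_s0]]]] := optimal_potentials (feasible_exists d P pi)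
  (fun la mu => value_ge0 d_der pi_res sqr (la := la) (mu := mu)).
have jac := jacobi_number_value d_der pi_res sqr feas tight_s0.
have det := system_det_value d_der pi_res sqr feas tight_s0.
have bound := alg_indep_le charF d_der PP_comp pi_res sqr feas.
have attained := alg_indep_exists charF d_der PP_comp pi_res sqr feas.
have nabla : ~ PP (system_det P PP) <-> \det (leading_mx d P pi la mu) != 0.
  case: pi_res => pi_ker _ _ _; rewrite -det.
  by split=> [nP|/eqP ne /pi_ker //]; apply/eqP => /pi_ker.
rewrite jac; set O := (_ - _)%N in bound attained *.
pose S := [set m : nat |
  exists t : 'I_m -> G, alg_indep (residue_const pi) t]%classic.
have S_le m : S m -> (m <= O)%N by case=> t /bound[].
have -> : component_order pi =
    supremum -oo%E [set (m%:Z)%:E | m in S]%classic by [].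
have [[S0 ->]|[M [SM maxM ->]]] := supremum_nat S_le.
  split; first exact: leNye.
  by split=> // /nabla/attained SO; have : S O := SO; rewrite S0.
split; first by rewrite lee_fin lez_nat; exact: S_le.
split=> [[eMO]|/nabla/attained SO].
  apply/nabla/eqP => det0; have [t /bound[_ /(_ det0)]] := SM.
  by rewrite eMO ltnn.
by congr ((_%:Z)%:E)%E; apply/eqP; rewrite eqn_leq S_le // maxM.
Qed.
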